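(* Let $N\ge 1$ and $q\ge 1$ be integers, $\beta>0$, and let $\varepsilon_1\le\varepsilon_2\le\cdots$ be the (infinite) sequence of single-particle energy eigenvalues, listed with multiplicity, with $\sum_{i}e^{-\beta\varepsilon_i}<\infty$. Let $Z_q(\beta,N)$ be the canonical partition function of the ideal Gentile gas of $N$ particles with maximum occupation number $q$ and this single-particle spectrum. Then $$Z_q(\beta,N)=\sum_{I=1}^{P(N)}Q^I(q)\,(\lambda)_I\left(e^{-\beta\varepsilon_1},e^{-\beta\varepsilon_2},\dots\right),$$ where $(\lambda)_I(x_1,x_2,\dots)$ is the $S$-function corresponding to the $I$-th integer partition $(\lambda)_I$ of $N$, and $$Q^I(q)=\sum_{K=1}^{P(N)}(k^{-1})_K^I\,\Gamma^K(q),\qquad \Gamma^K(q)=\begin{cases}0,&\lambda_{K,1}>q,\\ 1,&\lambda_{K,1}\le q,\end{cases}$$ with $\lambda_{K,1}$ the largest part of $(\lambda)_K$, and $(k^{-1})_K^I$ the inverse Kostka numbers, determined by $\sum_{I=1}^{P(N)}(k^{-1})_K^I\,k_I^L=\delta_K^L$ for all $1\le K,L\le P(N)$, where $k_I^L$ are the Kostka numbers.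
   Context: Canonical partition function: for an $N$-particle system, $Z(\beta,N)=\sum_s e^{-\beta E_s}$, summed over all states $s$ of the system with energies $E_s$. For an ideal Gentile gas of $N$ particles with maximum occupation number $q$, a state is a sequence of occupation numbers $(n_i)_{i\ge1}$ with each $n_i\in\{0,1,\dots,q\}$ and $\sum_i n_i=N$, and its energy is $\sum_i n_i\varepsilon_i$. Integer partitions: list all $P(N)$ integer partitions of $N$ as $(\lambda)_1,\dots,(\lambda)_{P(N)}$ in decreasing lexicographic order, parts in descending order, so $(\lambda)_1=(N)$ and $(\lambda)_{P(N)}=(1^N)$; $\lambda_{J,i}$ is the $i$-th part of $(\lambda)_J$. Let $a_{J,m}$ be the number of times $m$ occurs as a part of $(\lambda)_J$, and $g_J=N!\left(\prod_{j=1}^N j^{a_{J,j}}a_{J,j}!\right)^{-1}$. $S$-function (Schur function) of infinitely many variables corresponding to $(\lambda)_I$: $$(\lambda)_I(x_1,x_2,\dots)=\sum_{J=1}^{P(N)}\frac{g_J}{N!}\,\chi_J^I\prod_{m=1}^{N}\Big(\sum_i x_i^m\Big)^{a_{J,m}},$$ where $\chi^I_J$ is the value of the irreducible character of the symmetric group $S_N$ indexed by the partition $(\lambda)_I$ on the conjugacy class of cycle type $(\lambda)_J$ (with the convention that $(N)$ indexes the trivial character and $(1^N)$ the sign character). Kostka numbers: $k_K^I$ is the number of semistandard Young tableaux of shape $(\lambda)_K$ and weight (content) $(\lambda)_I$; equivalently, the coefficients in $(\lambda)_K(x_1,x_2,\dots)=\sum_{I=1}^{P(N)}k_K^I\,m_{(\lambda)_I}(x_1,x_2,\dots)$,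 where $m_{(\lambda)}$ is the monomial symmetric function, i.e. the sum of all distinct monomials whose nonzero exponents, sorted in descending order, form $(\lambda)$. *)

(* Defs.v *)
(* Mathematical Components + MathComp-Analysis. *)
From HB Require Import structures.
From mathcomp Require Import all_boot all_order all_algebra all_fingroup.
From mathcomp Require Import all_solvable all_field all_character finmap.
From mathcomp Require Import all_classical all_reals all_analysis.

Set Implicit Arguments.
Unset Strict Implicit.
Unset Printing Implicit Defensive.

Import Order.TTheory GRing.Theory Num.Theory.
Import numFieldNormedType.Exports.

Local Open Scope ring_scope.

(* Partitions of n into parts at most m, in decreasing lexicographic order;
   the fuel k suffices when n <= k.  *)
Fixpoint bounded_parts (k m n : nat) : seq (seq nat) :=
  if n == 0%N then [:: [::]] else
  if k is k'.+1 then
    [seq j :: p | j <- rev (iota 1 (minn m n)),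
                  p <- bounded_parts k' j (n - j)%N]
  else [::].

Definition intparts (N : nat) : seq (seq nat) := bounded_parts N N N.

Lemma mem_bounded_parts k m n p : (n <= k)%N ->
  (p \in bounded_parts k m n) =
  [&& path geq m p, 0%N \notin p & sumn p == n].
Proof.
have nil m' p' :
    (p' \in [:: [::]]) = [&& path geq m' p', 0%N \notin p' & sumn p' == 0%N].
  case: p' => [|[|j] p'] //=; rewrite ?inE ?andbF //.
elim: k m n p => [|k IH] m n p.
  by rewrite leqn0 => /eqP->; apply: nil.
move=> lenk /=; case: eqP => [->|/eqP n0]; first exact: nil.
have mi j : (j \in rev (iota 1 (minn m n))) = [&& 0 < j, j <= m & j <= n]%N.
  by rewrite mem_rev mem_iota add1n ltnS leq_min.
have IH' j p' : (0 < j)%N ->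
    (p' \in bounded_parts k j (n - j)%N) =
    [&& path geq j p', 0%N \notin p' & sumn p' == (n - j)%N].
  by move=> j0; apply: IH; rewrite leq_subLR (leq_trans lenk) // -add1n leq_add2r.
apply/allpairsPdep/idP => [[j [p' []]]|].
  rewrite mi => /and3P[j0 jm jn]; rewrite IH' // => /and3P[pp p0 /eqP sp] -> /=.
  by rewrite jm pp in_cons negb_or eq_sym -lt0n j0 p0 sp subnKC //=.
case: p => [|j p] /=; first by rewrite eq_sym (negPf n0).
rewrite in_cons negb_or eq_sym -lt0n.
move=> /and3P[/andP[jm pp] /andP[j0 p0] /eqP sp].
exists j, p; split => //; first by rewrite mi j0 jm -sp leq_addr.
by rewrite IH' // pp p0 -sp addKn /=.
Qed.

Lemma mem_intparts N p :
  (p \in intparts N) = [&& sorted geq p, 0%N \notin p & sumn p == N].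
Proof.
rewrite mem_bounded_parts //; case: p => //= j p.
case: eqP => [<-|]; last by rewrite !andbF.
by rewrite leq_addr.
Qed.

Lemma intparts_sorted N :
  sorted (fun p r : seqlexi nat => (r < p)%O) (intparts N).
Proof.
suff: forall k m n, sorted (fun p r : seqlexi nat => (r < p)%O)
                           (bounded_parts k m n) by apply.
elim=> [|k IH] m n /=; first by case: eqP.
have tr : transitive (fun p r : seqlexi nat => (r < p)%O).
  by move=> y x z /= yx zy; apply: lt_trans zy yx.
case: eqP => // _; rewrite (sorted_pairwise tr).
have: sorted gtn (rev (iota 1 (minn m n))).
  by rewrite rev_sorted; apply: iota_ltn_sorted.
have trg : transitive gtn by move=> y x z /= yx zy; apply: ltn_trans zy yx.
rewrite (sorted_pairwise trg).
elim: (rev _) => //= j s IHs /andP[js ss].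
rewrite pairwise_cat IHs // andbT; apply/andP; split.
  apply/allrelP => _ _ /mapP[p _ ->] /allpairsPdep[i [r [si _ ->]]].
  by have := allP js _ si => /= ij; rewrite neqhead_ltxiE // neq_ltn ij.
rewrite pairwise_map.
have := IH j (n - j)%N; rewrite (sorted_pairwise tr).
by apply: sub_pairwise => p r /= pr; rewrite eqhead_ltxiE.
Qed.

Definition nparts (N : nat) : nat := size (intparts N).

(* Indices start at 0: [part I] is $(\lambda)_{I+1}$, and its first, largest
   part is entry 0.  *)
Definition part (N : nat) (I : 'I_(nparts N)) : seq nat :=
  nth [::] (intparts N) I.

(* The boxes of a diagram of size N are labelled by 'I_N, row after row, so that
   [row_of lam x] and [col_of lam x] are the coordinates of the box x.  *)
Definition row_of (lam : seq nat) (x : nat) : nat := reshape_index lam x.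
Definition col_of (lam : seq nat) (x : nat) : nat := reshape_offset lam x.

(* A tableau fills the boxes with letters in 'I_N, the letter m standing for the
   positive integer m + 1.  *)
Definition ssyt (N : nat) (lam mu : seq nat) : {set {ffun 'I_N -> 'I_N}} :=
  [set T : {ffun 'I_N -> 'I_N} |
    [&& [forall x : 'I_N, forall y : 'I_N,
           (row_of lam x == row_of lam y) && (col_of lam x <= col_of lam y)%N
             ==> (T x <= T y)%N],
        [forall x : 'I_N, forall y : 'I_N,
           (col_of lam x == col_of lam y) && (row_of lam x < row_of lam y)%N
             ==> (T x < T y)%N]
      & [forall m : 'I_N, #|[pred x | T x == m]| == nth 0%N mu m]]].

(* Row index: shape; column index: weight.  *)
Definition kostka (N : nat) : 'M[int]_(nparts N) :=
  \matrix_(K, I) #|ssyt N (part K) (part I)|%:Z.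

(* [kostka N] is unitriangular, hence invertible over int.  *)
Definition inv_kostka (N : nat) : 'M[int]_(nparts N) := invmx (kostka N).

Definition Gam (N q : nat) (K : 'I_(nparts N)) : int :=
  if (q < nth 0 (part K) 0)%N then 0 else 1.

Definition Qcoef (N q : nat) (I : 'I_(nparts N)) : int :=
  \sum_(K < nparts N) inv_kostka N K I * Gam q K.

Section SymmetricGroup.
Variable N : nat.

Definition fiber_stab (f : 'I_N -> nat) : {set 'S_N} :=
  [set s : 'S_N | [forall x, f (s x) == f x]].

Lemma fiber_stab_group_set f : group_set (fiber_stab f).
Proof.
apply/group_setP; split=> [|s t]; first by rewrite inE; apply/forallP=> x; rewrite perm1.
rewrite !inE => /forallP fs /forallP ft.
by apply/forallP=> x; rewrite permM (eqP (ft _)).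
Qed.

Canonical fiber_stab_group f := Group (fiber_stab_group_set f).

Lemma sgn_class_fun :
  is_class_fun <<[set: 'S_N]>>%g [ffun s : 'S_N => (-1) ^+ odd_perm s].
Proof.
apply: intro_class_fun => [s t _ _|s]; first by rewrite odd_permJ.
by rewrite mem_gen ?inE.
Qed.

Definition sgn_char : 'CF([set: 'S_N]) := Cfun 0 sgn_class_fun.

(* The irreducible character attached to lam is the common irreducible
   constituent of the characters induced from the trivial character of the row
   stabilizer and from the sign character of the column stabilizer of a tableau
   of shape lam (James and Kerber, The Representation Theory of the Symmetric
   Group, 2.1).  With lam = (N) this is the trivial character, with lam = (1^N)
   the sign character.  *)
Definition common_constituent (lam : seq nat) (i : Iirr [set: 'S_N]) : bool :=
  (i \in irr_constt
     ('Ind[[set: 'S_N]] (1 : 'CF(fiber_stab (fun x => row_of lam x)))))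
  && (i \in irr_constt
     ('Ind[[set: 'S_N]] ('Res[fiber_stab (fun x => col_of lam x)] sgn_char))).

Definition sym_char (lam : seq nat) : 'CF([set: 'S_N]) :=
  'chi_(odflt 0 [pick i | common_constituent lam i]).

Definition cycle_type (s : 'S_N) : seq nat :=
  sort geq [seq #|pred_of_set X| | X in porbits s].

(* The irreducible characters of 'S_N take rational integer values, so the floor
   only moves these values from algC to int.  *)
Definition chi_val (I J : 'I_(nparts N)) : int :=
  Num.floor (sym_char (part I)
               (repr [set s : 'S_N | cycle_type s == part J])).

End SymmetricGroup.

Section GentileGas.
Variable R : realType.

Definition mult (N : nat) (J : 'I_(nparts N)) (m : nat) : nat :=
  count_mem m (part J).

Definition g_coef (N : nat) (J : 'I_(nparts N)) : R :=
  N`!%:R / (\prod_(1 <= j < N.+1) (j ^ mult J j * (mult J j)`!)%N)%:R.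

Definition power_sum (x : nat -> R) (m : nat) : R :=
  limn (series (fun i => x i ^+ m)).

Definition S_function (N : nat) (I : 'I_(nparts N)) (x : nat -> R) : R :=
  \sum_(J < nparts N) g_coef J / N`!%:R * (chi_val I J)%:~R *
    \prod_(1 <= m < N.+1) power_sum x m ^+ mult J m.

Definition canonical_Z (S : choiceType) (states : set S) (E : S -> R)
    (beta : R) : \bar R :=
  \esum_(s in states) (expR (- beta * E s))%:E.

(* A sequence of occupation numbers with a finite sum has finite support; the
   single-particle levels are numbered from 0.  *)
Definition occupation := {fsfun nat -> nat with 0%N}.

Definition gentile_states (N q : nat) : set occupation :=
  [set n : occupation | (forall i, (n i <= q)%N) /\
                        (\sum_(i <- finsupp n) n i)%N = N].

Definition gentile_energy (eps : nat -> R) (n : occupation) : R :=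
  \sum_(i <- finsupp n) (n i)%:R * eps i.

Definition gentile_Z (eps : nat -> R) (q : nat) (beta : R) (N : nat) : \bar R :=
  canonical_Z (gentile_states N q) (gentile_energy eps) beta.

End GentileGas.

(* Main.v *)
Require Import Defs.
From mathcomp Require Import all_boot all_order all_algebra all_fingroup.
From mathcomp Require Import all_field all_character finmap.
From mathcomp Require Import all_classical all_reals all_analysis.
From mathcomp Require Import zify ring.
Import Order.TTheory GRing.Theory Num.Theory.
Import numFieldNormedType.Exports.
Local Open Scope ring_scope.

Set Implicit Arguments.
Unset Strict Implicit.
Unset Printing Implicit Defensive.

(* Interlacing shapes carry a reflection ("local rule") that exchanges adding
   and removing a horizontal strip; iterating it gives the enumerative form of
   the Robinson-Schensted-Knuth correspondence: with K the Kostka matrix,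
   (K^T K)_(L,M) counts the matrices of nonnegative integers with row sums L and
   column sums M.  By Burnside's lemma the same numbers are the inner products
   of the permutation characters of S_N on words of content L and M.  As K is
   unitriangular, applying its inverse to these permutation characters gives
   orthonormal virtual characters, hence irreducible characters up to a sign,
   and the diagonal of K fixes the sign.  Dominance in both directions
   identifies them with the common constituents that define the characters
   chi^I.  Therefore sum_I Q^I chi^I pairs with the permutation character on
   words of content c to 1 if all multiplicities of c are at most q and to 0
   otherwise.  Summing over S_N the functions fixed by a permutation gives the
   identity for finitely many levels, and it passes to the limit.

   The class sizes N! / z_J are not computed directly: the weights 1 / z_J and
   |class J| / N! give the same mean to every permutation character, by Newton's
   identity and by Frobenius reciprocity, and the table of these characters is
   invertible because its Gram matrix is K^T K. *)

(** * Shapes and horizontal strips *)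

(** The definition of chi^I as a common constituent gives no formula for its values. The proof asks
    only for the pairing of chi^I with each permutation character on words; this pairing is a Kostka
    number, and the inverse Kostka matrix inside Q^I undoes precisely it, so Q^I never has to be
    computed. The count of matrices rests on a commutation rule: adding a strip of size a and then
    removing one of size b amounts to removing b - j boxes and then adding a - j, summed over j, and
    j becomes an entry of the matrix. Occupation numbers come unsorted, whereas the Kostka matrix
    knows only sorted weights. The symmetry of Kostka numbers in the weight is therefore needed, and
    it is read off the characters: relabelling the letters of a word changes neither its stabilizer
    nor the induced character. *)

Section Shapes.
Variable N : nat.

(** Monotonicity is not built in: [interlace k l] forces both [k] and [l] to be nonincreasing. The
    row of index N is spare, so that a shape with N rows has room for the row that a horizontal
    strip may add. *)
Definition shape := {ffun 'I_N.+1 -> 'I_N.+1}.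

Definition rowlen (l : shape) (i : nat) : nat :=
  if insub i is Some j then l j : nat else 0%N.

Definition shape_of (f : nat -> nat) : shape := [ffun i : 'I_N.+1 => inord (f i)].

Definition weight (l : shape) : nat := (\sum_(i < N.+1) rowlen l i)%N.

Definition interlace (k l : shape) : bool :=
  [forall i : 'I_N.+1, (rowlen l i.+1 <= rowlen k i <= rowlen l i)%N].

Lemma rowlenE (l : shape) (i : 'I_N.+1) : rowlen l i = l i.
Proof. by rewrite /rowlen valK. Qed.

Lemma rowlen_ge (l : shape) i : (N < i)%N -> rowlen l i = 0%N.
Proof. by move=> Ni; rewrite /rowlen insubF // ltnS leqNgt Ni. Qed.

Lemma rowlen_leN (l : shape) i : (rowlen l i <= N)%N.
Proof. by rewrite /rowlen; case: insub => [j|//]; rewrite -ltnS. Qed.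

Lemma rowlen_shape_of f i : (i <= N)%N -> (f i <= N)%N -> rowlen (shape_of f) i = f i.
Proof.
move=> iN fN; have iN' : (i < N.+1)%N by [].
by rewrite (rowlenE _ (Ordinal iN')) ffunE /= inordK.
Qed.

Lemma shapeP (k l : shape) : (forall i, (i <= N)%N -> rowlen k i = rowlen l i) -> k = l.
Proof.
move=> e; apply/ffunP=> i; apply: val_inj; rewrite /= -!rowlenE.
by apply: e; rewrite -ltnS.
Qed.

Lemma interlaceP (k l : shape) :
  reflect (forall i, (rowlen l i.+1 <= rowlen k i <= rowlen l i)%N) (interlace k l).
Proof.
apply: (iffP forallP) => [h i|h i]; last exact: h.
case: (ltnP i N.+1) => iN; first exact: (h (Ordinal iN)).
by rewrite !rowlen_ge // ltnW.
Qed.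

Lemma rowlen_le_weight (l : shape) i : (rowlen l i <= weight l)%N.
Proof.
case: (ltnP i N.+1) => iN; last by rewrite rowlen_ge.
by rewrite /weight (bigD1 (Ordinal iN)) //= leq_addr.
Qed.

Lemma interlace_weight (k l : shape) : interlace k l -> (weight k <= weight l)%N.
Proof. by move/interlaceP=> h; apply: leq_sum => i _; case/andP: (h i). Qed.

Section LocalRule.
Variables (k m : shape) (n : nat).
Hypotheses (kN : rowlen k N = 0%N) (nN : (n <= N)%N).

Let mi i := minn (rowlen k i) (rowlen m i).
Let ma i := maxn (rowlen k i) (rowlen m i).

(** Row 0 is chosen to give weight n. As |r| + |up r| + [ma 0] equals |k| + |m| plus row 0 of
    [up r], the inequality |k| + |m| <= n + |r| says exactly that this row is at least [ma 0]. *)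
Let up (r : shape) : shape := shape_of (fun i =>
  if i is j.+1 then (mi j + ma j.+1 - rowlen r j)%N
  else (n + weight r + ma 0 - (weight k + weight m))%N).

Let down (v : shape) : shape := shape_of (fun i =>
  (mi i + ma i.+1 - rowlen v i.+1)%N).

Let sum_mima : (\sum_(i < N.+1) (mi i + ma i.+1) + ma 0 = weight k + weight m)%N.
Proof.
have -> : (weight k + weight m = \sum_(i < N.+1) (mi i + ma i))%N.
  by rewrite /weight -big_split; apply: eq_bigr => i _; rewrite /mi /ma addn_min_max.
rewrite !big_split /= -addnA; congr addn.
rewrite big_ord_recr /= [RHS]big_ord_recl /= /ma !(@rowlen_ge _ N.+1) // maxnn addn0 addnC.
by [].
Qed.

Let downE v : interlace k v -> interlace m v -> forall i, (i <= N)%N ->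
  rowlen (down v) i = (mi i + ma i.+1 - rowlen v i.+1)%N.
Proof.
move=> /interlaceP kv /interlaceP mv i iN; rewrite rowlen_shape_of //.
move: (kv i) (mv i) (kv i.+1) (mv i.+1) (rowlen_leN k i) (rowlen_leN m i).
rewrite /mi /ma; lia.
Qed.

Let upES r : interlace r k -> interlace r m -> forall i, (i < N)%N ->
  rowlen (up r) i.+1 = (mi i + ma i.+1 - rowlen r i)%N.
Proof.
move=> /interlaceP kv /interlaceP mv i iN; rewrite rowlen_shape_of //.
move: (kv i) (mv i) (kv i.+1) (mv i.+1) (rowlen_leN k i) (rowlen_leN m i).
rewrite /mi /ma; lia.
Qed.

Let mima_le0 r : interlace r k -> interlace r m -> (weight k + weight m <= n + weight r)%N ->
  (n + weight r + ma 0 - (weight k + weight m) <= N)%N.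
Proof.
move=> /interlaceP kv /interlaceP mv le.
have : (weight r <= \sum_(i < N.+1) mi i)%N.
  by apply: leq_sum => i _; move: (kv i) (mv i); rewrite /mi; lia.
have := sum_mima; rewrite big_split /=.
lia.
Qed.

Let upE0 r : interlace r k -> interlace r m -> (weight k + weight m <= n + weight r)%N ->
  rowlen (up r) 0 = (n + weight r + ma 0 - (weight k + weight m))%N.
Proof. by move=> rk rm le; rewrite rowlen_shape_of // mima_le0. Qed.

Let sum_downE v : interlace k v -> interlace m v ->
  (weight (down v) + weight v + ma 0 = weight k + weight m + rowlen v 0)%N.
Proof.
move=> kv mv.
have e : (weight (down v) + \sum_(i < N.+1) rowlen v i.+1 = \sum_(i < N.+1) (mi i + ma i.+1))%N.
  rewrite /weight -big_split; apply: eq_bigr => i _; rewrite downE //=; last by rewrite -ltnS.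
  move/interlaceP: kv => /(_ i) ; move/interlaceP: mv => /(_ i); rewrite /mi /ma; lia.
have e2 : (weight v = rowlen v 0 + \sum_(i < N.+1) rowlen v i.+1)%N.
  by rewrite /weight big_ord_recl [in RHS]big_ord_recr /= (@rowlen_ge v N.+1) // addn0.
by have := sum_mima; lia.
Qed.

Lemma local_rule_fwd v :
  interlace k v && interlace m v && (weight v == n) ->
  [&& interlace (down v) k, interlace (down v) m &
      (weight k + weight m <= n + weight (down v))%N] /\ up (down v) = v.
Proof.
move=> /andP[/andP[kv mv] /eqP vn].
have dk : interlace (down v) k.
  apply/interlaceP => i; case: (ltnP i N.+1) => iN; last first.
    by rewrite !rowlen_ge //; lia.
  rewrite downE //.
  move/interlaceP: kv => kv; move/interlaceP: mv => mv.
  move: (kv i) (mv i) (kv i.+1) (mv i.+1); rewrite /mi /ma; lia.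
have dm : interlace (down v) m.
  apply/interlaceP => i; case: (ltnP i N.+1) => iN; last first.
    by rewrite !rowlen_ge //; lia.
  rewrite downE //.
  move/interlaceP: kv => kv; move/interlaceP: mv => mv.
  move: (kv i) (mv i) (kv i.+1) (mv i.+1); rewrite /mi /ma; lia.
have s := sum_downE kv mv.
have le : (weight k + weight m <= n + weight (down v))%N.
  move/interlaceP: kv => /(_ 0%N); move/interlaceP: mv => /(_ 0%N).
  move: s; rewrite /ma; lia.
split; first by rewrite dk dm le.
apply: shapeP => -[|i] iN.
  by rewrite upE0 //; lia.
rewrite upES // downE //; last exact: ltnW.
move/interlaceP: kv => /(_ i); move/interlaceP: mv => /(_ i).
rewrite /mi /ma; lia.
Qed.

Lemma local_rule_bwd r :
  [&& interlace r k, interlace r m & (weight k + weight m <= n + weight r)%N] ->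
  interlace k (up r) && interlace m (up r) && (weight (up r) == n) /\ down (up r) = r.
Proof.
move=> /and3P[rk rm le].
have rk' := interlaceP _ _ rk; have rm' := interlaceP _ _ rm.
have U1 : forall i, rowlen (up r) i.+1 = (mi i + ma i.+1 - rowlen r i)%N.
  move=> i; case: (ltnP i N) => iN; first exact: upES.
  rewrite rowlen_ge //.
  (* Here i >= N, and the empty row N of [k] leaves no room for a row i+1 in [up r]. *)
  have -> : mi i = 0%N.
    apply/eqP; rewrite -leqn0; apply: leq_trans (geq_minl _ _) _.
    by move: iN; rewrite leq_eqVlt => /orP[/eqP<-|iN]; rewrite ?kN // rowlen_ge.
  by rewrite /ma (@rowlen_ge k) // (@rowlen_ge m) // maxnn sub0n.
have U0 := upE0 rk rm le.
have kv : interlace k (up r).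
  apply/interlaceP => -[|i]; rewrite U1 ?U0 ?U1.
    by move: (rk' 0%N) (rm' 0%N); rewrite /mi /ma; lia.
  by move: (rk' i) (rm' i) (rk' i.+1) (rm' i.+1); rewrite /mi /ma; lia.
have mv : interlace m (up r).
  apply/interlaceP => -[|i]; rewrite U1 ?U0 ?U1.
    by move: (rk' 0%N) (rm' 0%N); rewrite /mi /ma; lia.
  by move: (rk' i) (rm' i) (rk' i.+1) (rm' i.+1); rewrite /mi /ma; lia.
have du : down (up r) = r.
  apply: shapeP => i iN; rewrite downE // U1.
  by move: (rk' i) (rm' i); rewrite /mi /ma; lia.
split; last exact: du.
rewrite kv mv /=; have := sum_downE kv mv; rewrite du U0; lia.
Qed.

(* Reflecting each row of [v] but the first in the interval to which
   interlacing confines it gives a shape [r] below both; the first row of [v]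
   is recovered from [weight v]. *)
Lemma card_local_rule :
  (\sum_(v : shape | interlace k v && interlace m v && (weight v == n)) 1 =
   \sum_(r : shape | [&& interlace r k, interlace r m &
                       (weight k + weight m <= n + weight r)%N]) 1)%N.
Proof.
rewrite (reindex_onto up down) => [|v /local_rule_fwd[]//].
apply: eq_bigl => r; apply/andP/idP => [[/local_rule_fwd[]]|].
  by move=> h _ /eqP rE; rewrite rE in h.
by move=> /local_rule_bwd[-> ->].
Qed.

End LocalRule.

(* The head of [s] is the size of the strip added last. *)
Fixpoint chains (s : seq nat) (l : shape) : nat :=
  if s is a :: s' then
    (\sum_(k : shape | interlace k l && (weight k + a == weight l)) chains s' k)%N
  else (weight l == 0)%N.

Definition subtract_row (t c : seq nat) : seq nat := [seq (p.1 - p.2)%N | p <- zip t c].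

Fixpoint bounded_rows (a : nat) (t : seq nat) : seq (seq nat) :=
  if t is b :: t' then
    [seq j :: c | j <- iota 0 (minn a b).+1, c <- bounded_rows (a - j) t']
  else if a == 0%N then [:: [::]] else [::].

(** [t] carries the column sums still to be filled, so the recursion on the rows runs parallel to
    the removal of strips in [sum_chains_mul]. *)
Fixpoint margin_matrices (s t : seq nat) : seq (seq (seq nat)) :=
  if s is a :: s' then [seq c :: C | c <- bounded_rows a t, C <- margin_matrices s' (subtract_row t c)]
  else if all (pred1 0%N) t then [:: [::]] else [::].

Lemma weight_eq0 (l : shape) : (weight l == 0%N) = (l == [ffun=> ord0]).
Proof.
apply/eqP/eqP => [w0|->].
  apply/ffunP => i; apply: val_inj; rewrite ffunE /= -rowlenE; apply/eqP.
  by rewrite -leqn0 -w0 rowlen_le_weight.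
by rewrite /weight big1 // => i _; rewrite rowlenE ffunE.
Qed.

Lemma chains_weight s l : chains s l != 0%N -> weight l = sumn s.
Proof.
elim: s l => [|a s IH] l /=; first by case: (weight l =P 0%N).
rewrite sum_nat_eq0 negb_forall => /existsP[k]; rewrite negb_imply.
by case/andP => /andP[_ /eqP<-] /IH->; rewrite addnC.
Qed.

Lemma chains_rows s l i : chains s l != 0%N -> (size s <= i)%N -> rowlen l i = 0%N.
Proof.
elim: s l i => [|a s IH] l i /=.
  case: (weight l =P 0%N) => // w0 _ _; apply/eqP; rewrite -leqn0 -w0; exact: rowlen_le_weight.
rewrite sum_nat_eq0 negb_forall => /existsP[k]; rewrite negb_imply.
case/andP => /andP[/interlaceP kl _] ck; case: i => // i si.
by have := kl i; rewrite (IH _ _ ck) //; lia.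
Qed.

(** The j strips added first, listed at the end of [s], build a shape with at most j rows, and this
    shape is contained in [l]. *)
Lemma chains_dominance s l j : chains s l != 0%N -> (j <= size s)%N ->
  (sumn (drop (size s - j) s) <= \sum_(i < j) rowlen l i)%N.
Proof.
elim: s l => [|a s IH] l cl /= js; first by [].
case: (ltnP (size s) j) => sj.
  have -> : j = (size s).+1 by apply/eqP; rewrite eqn_leq js.
  rewrite subnn drop0 -(chains_weight cl) /weight.
  case: (leqP (size s).+1 N.+1) => sN; last first.
    rewrite -(big_mkord xpredT (rowlen l)) -(big_mkord xpredT (rowlen l)).
    by rewrite (big_cat_nat (leq0n N.+1) (ltnW sN)) /= leq_addr.
  rewrite -(big_mkord xpredT (rowlen l)) -(big_mkord xpredT (rowlen l)).
  rewrite (big_cat_nat (leq0n (size s).+1) sN) /= [X in (_ + X)%N]big1_seq ?addn0 // => i.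
  by rewrite mem_index_iota /= => /andP[si _]; apply: chains_rows cl _.
move: cl; rewrite /= sum_nat_eq0 negb_forall => /existsP[k]; rewrite negb_imply.
case/andP => /andP[/interlaceP kl _] ck; rewrite subSn //=.
apply: leq_trans (IH _ ck sj) _; apply: leq_sum => i _.
by case/andP: (kl i).
Qed.

Lemma rowlen0 i : rowlen [ffun=> ord0] i = 0%N.
Proof. by rewrite /rowlen; case: insub => //= ?; rewrite ffunE. Qed.

Lemma interlace00 : interlace [ffun=> ord0] [ffun=> ord0].
Proof. by apply/interlaceP => i; rewrite !rowlen0. Qed.

Lemma chains0 t : chains t [ffun=> ord0] = all (pred1 0%N) t.
Proof.
have w0 : weight [ffun=> ord0] = 0%N by apply/eqP; rewrite weight_eq0.
elim: t => [|b t IH] /=; first by rewrite w0.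
rewrite (bigID (pred1 ([ffun=> ord0] : shape))) /= [X in (_ + X)%N]big1 ?addn0; last first.
  move=> k /andP[/andP[_ /eqP]]; rewrite w0 => /eqP; rewrite addn_eq0.
  by rewrite weight_eq0 => /andP[->].
case: eqP => [->|b0].
  rewrite (big_pred1 [ffun=> ord0]) // => k /=; rewrite w0 addn0 weight_eq0.
  case: eqP => [->|]; rewrite ?andbF // !andbT.
  exact: interlace00.
rewrite big_pred0 // => k /=; apply/negP; rewrite w0 addn_eq0.
by case/andP => /andP[_ /andP[_ /eqP]].
Qed.

(* In symmetric functions: the adjoint of multiplication by h_a maps
   h_(t_1) h_(t_2) ... to the sum over c of the h_(t_1 - c_1) h_(t_2 - c_2) ... *)
Lemma sum_chains_over t (k : shape) a : rowlen k N = 0%N -> (weight k + a <= N)%N ->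
  (\sum_(v : shape | interlace k v && (weight v == weight k + a)) chains t v =
   \sum_(c <- bounded_rows a t) chains (subtract_row t c) k)%N.
Proof.
elim: t k a => [|b t IH] k a kN kaN.
  rewrite /=; case: eqP => [a0|a0]; last first.
    rewrite big_nil big1 // => v /andP[_ /eqP->].
    by rewrite addn_eq0; move/eqP/negPf: a0 => ->; rewrite andbF.
  rewrite big_seq1 /= a0 addn0; case: eqP => [w0|/eqP w0]; last first.
    by rewrite big1 // => v /andP[_ /eqP->]; rewrite (negPf w0).
  have k0 : k = [ffun=> ord0] by apply/eqP; rewrite -weight_eq0 w0.
  rewrite (big_pred1 k) => [|v]; first by rewrite w0.
  rewrite w0 weight_eq0 -k0 /= andbC; case: eqP => [->|//] /=.
  by rewrite k0 interlace00.
set n := (weight k + a)%N.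
(* Taking the strip of size b off v leaves m; the local rule then trades the v above [k] and m for
   the r below both. *)
transitivity (\sum_(m : shape) \sum_(r : shape | [&& weight m + b == n, interlace r k,
     interlace r m & weight k + weight m <= n + weight r]%N) chains t m)%N.
  rewrite /= (exchange_big_dep xpredT) //=; apply: eq_bigr => m _.
  transitivity (\sum_(v : shape | interlace k v && interlace m v && (weight v == n))
       ((weight m + b == n) * chains t m))%N.
    rewrite big_mkcond [RHS]big_mkcond; apply: eq_bigr => v _.
    case: (interlace k v); case: (interlace m v); rewrite /= ?andbF //.
    by case: eqP => //= ->; rewrite [in RHS]mulnbl.
  rewrite (eq_bigr (fun=> 1 * ((weight m + b == n) * chains t m))%N) => [|v _]; last by rewrite mul1n.
  rewrite -big_distrl card_local_rule // big_distrl /=.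
  case: eqP => _ /=; last by rewrite [RHS]big_pred0 // big1.
  by under eq_bigr do rewrite !mul1n.
rewrite big_allpairs_dep /=.
transitivity (\sum_(j <- iota 0 (minn a b).+1) \sum_(r : shape | interlace r k &&
     (weight r + (b - j) == weight k)%N) \sum_(m : shape | interlace r m &&
     (weight m == weight r + (a - j))%N) chains t m)%N; last first.
  rewrite big_seq_cond [RHS]big_seq_cond; apply: eq_bigr => j /andP[jab _].
  rewrite mem_iota in jab.
  rewrite [RHS]exchange_big /=; apply: eq_bigr => r /andP[rk /eqP rw].
  rewrite IH //; last by apply: leq_trans kaN; have := interlace_weight rk; lia.
  by move/interlaceP: rk => /(_ N); rewrite kN; lia.
(* Given m and r, only j = |r| + b - |k| contributes: the strips k/r and m/r have b - j and a - j
   boxes. The inequality of the local rule says that this j is not negative. *)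
transitivity (\sum_(m : shape) \sum_(r : shape) \sum_(j <- iota 0 (minn a b).+1)
  if j == (weight r + b - weight k)%N then
  if [&& weight m + b == n, interlace r k,
     interlace r m & weight k + weight m <= n + weight r]%N then chains t m else 0 else 0)%N.
  apply: eq_bigr => m _.
  rewrite big_mkcond; apply: eq_bigr => r _.
  case: ifP => [/and4P[/eqP mb rk rm le]|_]; last first.
    by rewrite big1 // => j _; case: ifP.
  have -> : iota 0 (minn a b).+1 = index_iota 0 (minn a b).+1 by rewrite /index_iota subn0.
  rewrite -big_mkcond big_nat1_eq /=; case: ifP => // /negP[].
  have := interlace_weight rk; have := interlace_weight rm; rewrite /n in mb le; lia.
symmetry.
rewrite (eq_bigr (fun j => \sum_(m : shape) \sum_(r : shape)
    if [&& interlace r k, weight r + (b - j) == weight k, interlace r m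
        & weight m == weight r + (a - j)]%N then chains t m else 0)%N) => [|j _]; last first.
  rewrite [RHS]exchange_big [LHS]big_mkcond; apply: eq_bigr => r _.
  case: (interlace r k && _) /andP => [[rk ->]|h]; last first.
    rewrite big1 // => m _; case: ifP => // /and4P[rk rw _ _].
    by case: h.
  rewrite big_mkcond; apply: eq_bigr => m _; by rewrite rk.
rewrite exchange_big; apply: eq_bigr => m _; rewrite exchange_big; apply: eq_bigr => r _.
rewrite big_seq [RHS]big_seq; apply: eq_bigr => j; rewrite mem_iota => jab.
case: (boolP (interlace r k)) => rk /=; last by rewrite andbF if_same.
case: (boolP (interlace r m)) => rm /=; last by rewrite !andbF if_same.
have := interlace_weight rk; have := interlace_weight rm; rewrite /n => mw kw.
by do ![case: ifP => //]; lia.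
Qed.

(** Each strip of [s] taken off v yields one row c of the matrix, through [sum_chains_over]. The
    bound on [size s] keeps row N of the remaining shape empty, as the local rule requires. *)
Lemma sum_chains_mul s t : (size s <= N)%N -> (sumn s <= N)%N ->
  (\sum_(v : shape) chains s v * chains t v = size (margin_matrices s t))%N.
Proof.
elim: s t => [|a s IH] t /=.
  move=> _ _; rewrite (bigD1 ([ffun=> ord0] : shape)) //= big1 => [|v v0]; last first.
    by rewrite weight_eq0 (negPf v0).
  by rewrite weight_eq0 eqxx mul1n addn0 chains0; case: ifP.
move=> sN aN; rewrite size_allpairs_dep sumnE big_map.
under [LHS]eq_bigr => v _ do rewrite big_distrl /=.
rewrite (exchange_big_dep xpredT) //=.
transitivity (\sum_(k : shape) chains s k * \sum_(c <- bounded_rows a t) chains (subtract_row t c) k)%N.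
  apply: eq_bigr => k _; case: (eqVneq (chains s k) 0%N) => [->|ck].
    by rewrite mul0n big1.
  rewrite -sum_chains_over; first last.
  - by rewrite (chains_weight ck) addnC.
  - by apply: chains_rows ck _; exact: ltnW.
  by rewrite big_distrr /=; apply: eq_bigl => v; rewrite [X in _ && X]eq_sym.
under [LHS]eq_bigr => k _ do rewrite big_distrr /=.
rewrite exchange_big; apply: eq_bigr => c _; apply: IH; first exact: ltnW.
by apply: leq_trans aN; rewrite leq_addl.
Qed.

End Shapes.

(** * Matrices with prescribed row and column sums *)

Lemma mem_bounded_rows a t c : c \in bounded_rows a t <->
  [/\ size c = size t, sumn c = a & forall j, (nth 0%N c j <= nth 0%N t j)%N].
Proof.
elim: t a c => [|b t IH] a c.
  rewrite /=; case: eqP => a0; rewrite inE.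
    split=> [/eqP->|[/size0nil->]]; by [split=> // j; rewrite nth_nil|].
  by split=> // -[/size0nil->]/= /esym.
split=> [/allpairsPdep[j [c' [+ /IH[sc ac le] ->]]]|[]].
  rewrite mem_iota => jab; split=> /=; rewrite ?sc ?ac //; first by lia.
  by case=> //=; lia.
case: c => // j c [sc] ac le; have {}ac : (j + sumn c)%N = a by [].
apply/allpairsPdep; exists j, c; split=> //.
  by rewrite mem_iota; have := le 0%N; rewrite /=; lia.
by apply/IH; split=> //; [lia|move=> i; exact: (le i.+1)].
Qed.

Lemma uniq_bounded_rows a t : uniq (bounded_rows a t).
Proof.
elim: t a => [|b t IH] a; first by rewrite /=; case: eqP.
apply: allpairs_uniq_dep => [|//|[j c] [j' c'] _ _ /= [-> ->]//].
exact: iota_uniq.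
Qed.

Lemma nth_subtract_row t c j : size c = size t ->
  nth 0%N (subtract_row t c) j = (nth 0%N t j - nth 0%N c j)%N.
Proof.
move=> sc; case: (ltnP j (size t)) => jt.
  by rewrite (nth_map (0, 0)%N) ?size_zip ?sc ?minnn // nth_zip ?sc.
by rewrite nth_default ?size_map ?size_zip ?sc ?minnn // (nth_default _ jt).
Qed.

Lemma size_subtract_row t c : size c = size t -> size (subtract_row t c) = size t.
Proof. by move=> sc; rewrite size_map size_zip sc minnn. Qed.

Lemma mem_margin_matrices s t C : C \in margin_matrices s t <->
  [/\ [seq sumn c | c <- C] = s, all (fun c => size c == size t) C &
      forall j, (\sum_(c <- C) nth 0%N c j)%N = nth 0%N t j].
Proof.
elim: s t C => [|a s IH] t C.
  rewrite /=; case: ifP => t0; rewrite inE.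
    split=> [/eqP->|[/(congr1 size)/eqP]]; last by rewrite size_map => /nilP->.
    split=> // j; rewrite big_nil; case: (ltnP j (size t)) => jt; last by rewrite nth_default.
    by apply/esym/eqP; exact: (allP t0 _ (mem_nth _ jt)).
  split=> // -[/(congr1 size)/eqP]; rewrite size_map => /nilP-> _ h.
  case/negP: t0; apply/(all_nthP 0%N) => j _; by rewrite /= -h big_nil.
split=> [/allpairsPdep[c [C' [/mem_bounded_rows[sc ac le] /IH[sC aC hC] ->]]]|[]].
  split=> /=; rewrite ?ac ?sC ?sc ?eqxx //=; first by move: aC; rewrite size_subtract_row.
  by move=> j; rewrite big_cons hC nth_subtract_row // subnKC.
case: C => // c C [ac sC] /= /andP[/eqP sc aC] h.
rewrite /=; apply/allpairsPdep; exists c, C; split=> //.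
  by apply/mem_bounded_rows; split=> // j; rewrite -h big_cons leq_addr.
apply/IH; split=> //; first by rewrite size_subtract_row.
by move=> j; rewrite nth_subtract_row // -h big_cons addKn.
Qed.

Lemma uniq_margin_matrices s t : uniq (margin_matrices s t).
Proof.
elim: s t => [|a s IH] t; first by rewrite /=; case: ifP.
apply: allpairs_uniq_dep => [|//|[j c] [j' c'] _ _ /= [-> ->]//].
exact: uniq_bounded_rows.
Qed.

(** The row sums bound the entries by N, which is why entries in ['I_N.+1] lose no matrix. *)
Lemma card_margin_matrices (N m n : nat) (s : 'I_m -> nat) (t : 'I_n -> nat) :
  (forall i, s i <= N)%N ->
  #|[set c : {ffun 'I_m * 'I_n -> 'I_N.+1} |
      [forall i, (\sum_j c (i, j) == s i)%N] && [forall j, (\sum_i c (i, j) == t j)%N]]| =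
  size (margin_matrices [seq s i | i <- enum 'I_m] [seq t j | j <- enum 'I_n]).
Proof.
move=> sN; set A := [set c | _].
pose g (c : {ffun 'I_m * 'I_n -> 'I_N.+1}) :=
  [seq [seq c (i, j) : nat | j <- enum 'I_n] | i <- enum 'I_m].
have nthg c i j : nth 0%N (nth [::] (g c) (i : 'I_m)) (j : 'I_n) = c (i, j).
  rewrite /g (nth_map i) ?size_enum_ord ?ltn_ord // nth_ord_enum.
  by rewrite (nth_map j) ?size_enum_ord ?ltn_ord // nth_ord_enum.
rewrite cardE -(size_map g); apply: perm_size; apply: uniq_perm.
- rewrite map_inj_uniq ?enum_uniq // => c d cd; apply/ffunP => -[i j]; apply: val_inj => /=.
  by rewrite -!nthg cd.
- exact: uniq_margin_matrices.
have sumg (c : {ffun 'I_m * 'I_n -> 'I_N.+1}) i :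
    sumn [seq c (i, j) : nat | j <- enum 'I_n] = (\sum_j c (i, j))%N.
  by rewrite sumnE big_map big_enum.
move=> C; apply/mapP/idP.
  move=> [c]; rewrite mem_enum inE => /andP[/forallP hs /forallP ht] ->.
  apply/mem_margin_matrices; split.
  - rewrite -map_comp; apply: eq_map => i /=; by rewrite sumg; apply/eqP.
  - by apply/allP => _ /mapP[i _ ->]; rewrite !size_map.
  move=> j; rewrite big_map big_enum /=; case: (ltnP j n) => jn.
    rewrite (nth_map (Ordinal jn)) ?size_enum_ord // (nth_ord_enum _ (Ordinal jn)).
    rewrite -(eqP (ht _)); apply: eq_bigr => i _.
    by rewrite (nth_map (Ordinal jn)) ?size_enum_ord // (nth_ord_enum _ (Ordinal jn)).
  rewrite [RHS]nth_default; last by rewrite size_map size_enum_ord.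
  apply: big1 => i _.
  by rewrite nth_default // size_map size_enum_ord.
move=> /mem_margin_matrices[hs hz ht].
have sC : size C = m by rewrite -(size_map sumn) hs size_map size_enum_ord.
have sCi (i : 'I_m) : size (nth [::] C i) = n.
  have /(allP hz)/eqP-> : nth [::] C i \in C by rewrite mem_nth // sC.
  by rewrite size_map size_enum_ord.
have sumC (i : 'I_m) : sumn (nth [::] C i) = s i.
  have := congr1 (fun l => nth 0%N l i) hs.
  by rewrite /= (nth_map [::]) ?sC // (nth_map i) ?size_enum_ord ?ltn_ord // nth_ord_enum.
have CN (i : 'I_m) (j : 'I_n) : (nth 0 (nth [::] C i) j < N.+1)%N.
  rewrite ltnS; apply: leq_trans (sN i); rewrite -sumC sumnE (big_nth 0%N) big_mkord.
  by rewrite sCi (bigD1 j) //= leq_addr.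
pose c : {ffun 'I_m * 'I_n -> 'I_N.+1} := 
  [ffun p : 'I_m * 'I_n => inord (nth 0%N (nth [::] C p.1) p.2)].
have cE (i : 'I_m) (j : 'I_n) : c (i, j) = nth 0%N (nth [::] C i) j :> nat.
  by rewrite ffunE inordK.
exists c; last first.
  apply: (@eq_from_nth _ [::]) => [|i]; first by rewrite sC size_map size_enum_ord.
  rewrite sC => im; rewrite (nth_map (Ordinal im)) ?size_enum_ord //.
  rewrite (nth_ord_enum _ (Ordinal im)).
  apply: (@eq_from_nth _ 0%N) => [|j]; first by rewrite (sCi (Ordinal im)) size_map size_enum_ord.
  rewrite (sCi (Ordinal im)) => jn; rewrite (nth_map (Ordinal jn)) ?size_enum_ord //.
  by rewrite (nth_ord_enum _ (Ordinal jn)) cE.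
rewrite mem_enum inE; apply/andP; split; first apply/forallP => i.
  by under eq_bigr do rewrite cE; rewrite -sumC sumnE (big_nth 0%N) big_mkord sCi.
apply/forallP => j; under eq_bigr do rewrite cE.
have := ht j; rewrite (nth_map j) ?size_enum_ord // nth_ord_enum => <-.
by rewrite (big_nth [::]) big_mkord sC.
Qed.

(** * Semistandard tableaux *)

Section Tableaux.
Variables (N : nat) (lam : seq nat).
Hypothesis lamN : lam \in intparts N.

Local Notation row := (row_of lam).
Local Notation col := (col_of lam).

Lemma sumn_intpart : sumn lam = N.
Proof. by move: lamN; rewrite mem_intparts => /and3P[_ _ /eqP]. Qed.

Lemma intpart_nonincr i j : (i <= j)%N -> (nth 0%N lam j <= nth 0%N lam i)%N.
Proof.
move: lamN; rewrite mem_intparts => /and3P[s _ _] ij.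
case: (ltnP j (size lam)) => jl; last by rewrite nth_default.
have tr : transitive geq by move=> a b c /= ab bc; apply: leq_trans bc ab.
apply: (sorted_leq_nth tr leqnn 0%N s) => //; rewrite inE; exact: leq_ltn_trans jl.
Qed.

Lemma size_intpart : (size lam <= N)%N.
Proof.
have /and3P[_ z /eqP <-] : [&& sorted geq lam, 0%N \notin lam & sumn lam == N] by rewrite -mem_intparts.
elim: (lam) z => //= a l IH; rewrite inE negb_or => /andP[a0 /IH]; lia.
Qed.

Lemma intpart_leN i : (nth 0%N lam i <= N)%N.
Proof.
case: (ltnP i (size lam)) => il; last by rewrite nth_default.
by rewrite -sumn_intpart sumnE (big_nth 0%N) big_mkord (bigD1 (Ordinal il)) //= leq_addr.
Qed.

Lemma col_lt (x : 'I_N) : (col x < nth 0%N lam (row x))%N.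
Proof. by apply: reshape_offsetP; rewrite sumn_intpart. Qed.

Lemma row_lt (x : 'I_N) : (row x < size lam)%N.
Proof. by apply: reshape_indexP; rewrite sumn_intpart. Qed.

Lemma box_inj (x y : 'I_N) : row x = row y -> col x = col y -> x = y.
Proof.
move=> r c; apply: val_inj => /=.
have e (z : nat) : flatten_index lam (row z) (col z) = z by exact: reshape_indexK.
by rewrite -[LHS]e -[RHS]e r c.
Qed.

Lemma box_ex i j : (j < nth 0%N lam i)%N -> exists x : 'I_N, row x = i /\ col x = j.
Proof.
move=> ji; have il : (i < size lam)%N by case: ltnP => // il; rewrite nth_default in ji.
have xN : (flatten_index lam i j < N)%N by rewrite -sumn_intpart; apply: flatten_indexP.
by exists (Ordinal xN); rewrite /row_of /col_of /= flatten_indexKl // flatten_indexKr.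
Qed.

Lemma card_boxes (k : nat -> nat) : (forall i, (k i <= nth 0%N lam i)%N) ->
  #|[pred x : 'I_N | (col x < k (row x))%N]| = (\sum_(i < N.+1) k i)%N.
Proof.
move=> kl.
pose s := [seq (i, j) | i <- iota 0 N.+1, j <- iota 0 (k i)].
transitivity (size s).
  rewrite cardE -(size_map (fun x : 'I_N => (row x, col x))); apply: perm_size; apply: uniq_perm.
  - by rewrite map_inj_uniq ?enum_uniq // => x y [] /box_inj; apply.
  - by apply: allpairs_uniq_dep => [|i _|[a b] [c d] _ _ /= [-> ->]//]; exact: iota_uniq.
  move=> [i j]; apply/mapP/allpairsPdep.
    move=> [x]; rewrite mem_enum inE => xk ->; exists (row x), (col x); rewrite !mem_iota !add0n;
      split=> //=.
    by apply: leq_trans (row_lt x) _; apply: leq_trans size_intpart _.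
  move=> [i' [j' []]]; rewrite !mem_iota !add0n /= => iN jk [-> ->].
  have [x [xr xc]] := box_ex (leq_trans jk (kl i')).
  by exists x; rewrite ?mem_enum ?inE xr xc.
rewrite size_allpairs_dep sumnE big_map.
have -> : iota 0 N.+1 = index_iota 0 N.+1 by rewrite /index_iota subn0.
by rewrite big_mkord; apply: eq_bigr => i _; rewrite size_iota.
Qed.

Definition subshape (k : shape N) := forall i, (rowlen k i <= nth 0%N lam i)%N.

Lemma subshape_ext (k l : shape N) : subshape k -> subshape l ->
  (forall x : 'I_N, (col x < rowlen k (row x))%N = (col x < rowlen l (row x))%N) -> k = l.
Proof.
move=> sk sl e; apply: shapeP => i _; apply/eqP; rewrite eqn_leq.
apply/andP; split; rewrite leqNgt; apply/negP => h.
  have [x [xr xc]] := box_ex (leq_trans h (sk i)).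
  by have := e x; rewrite xr xc h ltnn.
have [x [xr xc]] := box_ex (leq_trans h (sl i)).
by have := e x; rewrite xr xc h ltnn.
Qed.

Lemma card_subshape (k : shape N) : subshape k ->
  #|[pred x : 'I_N | (col x < rowlen k (row x))%N]| = weight k.
Proof. by move=> sk; rewrite card_boxes. Qed.

(* Boxes outside the shape [k] carry the value [size s], and the weight [s]
   is listed from the largest letter erase_strip. *)
Definition fillings (k : shape N) (s : seq nat) : {set {ffun 'I_N -> 'I_N.+1}} :=
  [set T : {ffun 'I_N -> 'I_N.+1} |
   [&& [forall x, ((T x < size s)%N == (col x < rowlen k (row x))%N) && (T x <= size s)%N],
    [forall x : 'I_N, forall y : 'I_N, (row x == row y) && (col x <= col y)%N ==> (T x <= T y)%N],
    [forall x : 'I_N, forall y : 'I_N,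
       [&& col x == col y, (row x < row y)%N & (T y < size s)%N] ==> (T x < T y)%N] &
    [forall m : 'I_N.+1, (m < size s)%N ==>
       (#|[pred x | T x == m]| == nth 0%N s (size s - m.+1))]]].

Lemma fillingsP k s (T : {ffun 'I_N -> 'I_N.+1}) : reflect
  [/\ forall x : 'I_N, (T x < size s)%N = (col x < rowlen k (row x))%N /\ (T x <= size s)%N,
   forall x y : 'I_N, row x = row y -> (col x <= col y)%N -> (T x <= T y)%N,
   forall x y : 'I_N, col x = col y -> (row x < row y)%N -> (T y < size s)%N -> (T x < T y)%N &
   forall m : 'I_N.+1, (m < size s)%N -> #|[pred x | T x == m]| = nth 0%N s (size s - m.+1)]
  (T \in fillings k s).
Proof.
rewrite inE; apply: (iffP and4P) => -[hA hB hC hD]; split.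
- by move=> x; have /andP[/eqP-> ->] := forallP hA x.
- by move=> x y rxy cxy; have /implyP := forallP (forallP hB x) y; apply; rewrite rxy eqxx.
- by move=> x y cxy rxy Ty; have /implyP := forallP (forallP hC x) y; apply; rewrite cxy eqxx rxy.
- by move=> m ms; have /implyP/(_ ms)/eqP := forallP hD m.
- by apply/forallP=> x; have [-> ->] := hA x; rewrite eqxx.
- by apply/forallP=> x; apply/forallP=> y; apply/implyP => /andP[/eqP rxy cxy]; apply: hB.
- by apply/forallP=> x; apply/forallP=> y; apply/implyP => /and3P[/eqP cxy rxy Ty]; apply: hC.
- by apply/forallP=> m; apply/implyP => /hD ->.
Qed.

(** The boxes with letters below n, each row being measured by its last such column. When rows
    increase weakly these boxes are left-justified, and the measure is faithful. *)
Definition shape_below n (T : {ffun 'I_N -> 'I_N.+1}) : shape N :=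
  shape_of N (fun i => \max_(x : 'I_N | (row x == i) && (T x < n)%N) (col x).+1)%N.

Let sh_max n (T : {ffun 'I_N -> 'I_N.+1}) i :
  (\max_(x : 'I_N | (row x == i) && (T x < n)%N) (col x).+1 <= nth 0%N lam i)%N.
Proof. by apply/bigmax_leqP => x /andP[/eqP<- _]; exact: col_lt. Qed.

Let rowlen_sh n T i : (i <= N)%N ->
  rowlen (shape_below n T) i = (\max_(x : 'I_N | (row x == i) && (T x < n)%N) (col x).+1)%N.
Proof. by move=> iN; apply: rowlen_shape_of => //; apply: leq_trans (sh_max _ _ _) (intpart_leN i). Qed.

Let sub_sh n T : subshape (shape_below n T).
Proof.
move=> i; case: (leqP i N) => iN; first by rewrite rowlen_sh // sh_max.
by rewrite rowlen_ge.
Qed.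

Let shP n (T : {ffun 'I_N -> 'I_N.+1}) :
  (forall x y : 'I_N, row x = row y -> (col x <= col y)%N -> (T x <= T y)%N) ->
  forall x : 'I_N, (T x < n)%N = (col x < rowlen (shape_below n T) (row x))%N.
Proof.
move=> mono x; rewrite rowlen_sh; last first.
  by apply: leq_trans size_intpart; apply: ltnW; exact: row_lt.
apply/idP/idP => [Tx|].
  by apply: (@leq_bigmax_cond _ _ (fun x : 'I_N => (col x).+1) x); rewrite eqxx.
move=> h; apply/negPn/negP => Tx; move: h; apply/negP; rewrite -leqNgt.
apply/bigmax_leqP => y /andP[/eqP ry Ty]; rewrite ltnNge; apply/negP => cxy.
by case/negP: Tx; apply: leq_ltn_trans Ty; apply: mono.
Qed.

(** * Removing the boxes of the largest letter *)

Section Peel.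
Variables (k : shape N) (a : nat) (s : seq nat) (n : nat).
Hypotheses (sk : subshape k) (nE : size s = n) (sN : (n < N)%N).

(** In a filling of weight [s] the value n marks the boxes outside the smaller shape. [fill_strip]
    separates them into the strip inside [k], which gets the letter n, and the boxes outside [k],
    now marked n+1; [erase_strip] merges them again. *)
Definition fill_strip (T : {ffun 'I_N -> 'I_N.+1}) : {ffun 'I_N -> 'I_N.+1} :=
  [ffun x : 'I_N => if (T x < n)%N then T x else
             if (col x < rowlen k (row x))%N then inord n else inord n.+1].

Definition erase_strip (T : {ffun 'I_N -> 'I_N.+1}) : {ffun 'I_N -> 'I_N.+1} :=
  [ffun x => inord (minn (T x) n)].

Let downE (T : {ffun 'I_N -> 'I_N.+1}) (x : 'I_N) : erase_strip T x = minn (T x) n :> nat.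
Proof. by rewrite ffunE inordK // ltnS; apply: leq_trans (geq_minr _ _) (ltnW sN). Qed.

Let upE (T : {ffun 'I_N -> 'I_N.+1}) (x : 'I_N) : fill_strip T x = (if (T x < n)%N then T x : nat else
             if (col x < rowlen k (row x))%N then n else n.+1) :> nat.
Proof. by rewrite ffunE; do 2?case: ifP => // _; rewrite inordK // ltnS // ltnW. Qed.

Let fillings_sh (T : {ffun 'I_N -> 'I_N.+1}) : T \in fillings k (a :: s) ->
  interlace (shape_below n T) k && (weight (shape_below n T) + a == weight k)%N.
Proof.
move=> /fillingsP[]; rewrite /= ?nE => hA hB hC hD.
have shT := shP n hB.
have lek i : (rowlen (shape_below n T) i <= rowlen k i)%N.
  rewrite leqNgt; apply/negP => h.
  have [x [xr xc]] := box_ex (leq_trans h (sub_sh n T i)).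
  have := shT x; rewrite xr xc h => Tx.
  by have [] := hA x; rewrite xr xc ltnn ltnS ltnW.
apply/andP; split.
  (* Otherwise a box y of [k] in row i+1, with a letter at most n, lies below a box x with a letter
     at least n, and its column is not strict. *)
  apply/interlaceP => i; rewrite lek andbT leqNgt; apply/negP => h.
  have h1 := leq_trans h (sk i.+1).
  have [y [yr yc]] := box_ex h1.
  have [x [xr xc]] := box_ex (leq_trans h1 (intpart_nonincr (leqnSn i))).
  have Ty : (T y < n.+1)%N by have [-> _] := hA y; rewrite yr yc.
  have Txy : (T x < T y)%N by apply: hC; rewrite ?xc ?yc ?xr ?yr.
  have nTx : (n <= T x)%N by rewrite leqNgt shT xr xc ltnn.
  by have := leq_ltn_trans nTx (leq_trans Txy Ty); rewrite ltnn.
rewrite -(card_subshape (sub_sh n T)) -(card_subshape sk).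
have nN : (n < N.+1)%N by rewrite ltnS ltnW.
have := hD (Ordinal nN) (ltnSn n); rewrite /= subSS subnn /= => <-.
apply/eqP; rewrite -[RHS](cardID [pred x | (T x < n)%N]); congr addn; apply: eq_card => x.
  rewrite !inE -shT; have [<- _] := hA x; rewrite andbC.
  by case: (ltnP (T x) n) => //= Tx; rewrite ltnW.
rewrite !inE -val_eqE /=; have [<- _] := hA x; rewrite ?nE ltnS.
by case: ltngtP.
Qed.

Let down_fillings (T : {ffun 'I_N -> 'I_N.+1}) : T \in fillings k (a :: s) ->
  erase_strip T \in fillings (shape_below n T) s /\ fill_strip (erase_strip T) = T.
Proof.
move=> /fillingsP[]; rewrite /= ?nE => hA hB hC hD.
have shT := shP n hB.
have dT (x : 'I_N) : (erase_strip T x < n)%N = (T x < n)%N by rewrite downE; lia.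
split; last first.
  have E (x : 'I_N) : fill_strip (erase_strip T) x = T x :> nat.
    rewrite upE dT downE; have [<-] := hA x; do 2?case: ifP; lia.
  by apply/ffunP => x; apply: val_inj; exact: E.
apply/fillingsP; rewrite /= ?nE; split.
- by move=> x; rewrite ?nE dT shT downE geq_minr.
- by move=> x y rxy cxy; rewrite !downE; have := hB x y rxy cxy; lia.
- move=> x y cxy rxy; rewrite ?nE dT => Ty.
  have := hC x y cxy rxy (ltnW Ty); rewrite !downE; lia.
move=> m mn; have mN : (m < n.+1)%N by exact: ltnW.
have := hD m mN; rewrite /= subSS ?nE -(subnSK mn) /= => <-.
apply: eq_card => x; rewrite !inE -!val_eqE /= downE; move: mn; rewrite ?nE; lia.
Qed.

Let up_fillings (l : shape N) (T : {ffun 'I_N -> 'I_N.+1}) :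
  interlace l k -> (weight l + a == weight k)%N ->
  T \in fillings l s ->
  [/\ fill_strip T \in fillings k (a :: s), shape_below n (fill_strip T) = l &
      erase_strip (fill_strip T) = T].
Proof.
move=> /interlaceP lk /eqP wlk /fillingsP[]; rewrite ?nE => hA hB hC hD.
have sl : subshape l by move=> i; apply: leq_trans (sk i); case/andP: (lk i).
(* Interlacing compares neighbouring rows, but strict columns compare any two. *)
have ncr i j : (i < j)%N -> (rowlen k j <= rowlen l i)%N.
  elim: j => // j IH; rewrite ltnS leq_eqVlt => /orP[/eqP->|/IH]; first by case/andP: (lk j).
  by apply: leq_trans; have := lk j; have := lk j.+1; lia.
have uT (x : 'I_N) : (fill_strip T x < n)%N = (T x < n)%N.
  rewrite upE; do 2?case: ifP; lia.
have du : erase_strip (fill_strip T) = T.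
  have E (x : 'I_N) : erase_strip (fill_strip T) x = T x :> nat.
    rewrite downE upE; have [_] := hA x; do 2?case: ifP; lia.
  by apply/ffunP => x; apply: val_inj; exact: E.
have upB (x y : 'I_N) : row x = row y -> (col x <= col y)%N -> (fill_strip T x <= fill_strip T y)%N.
  move=> rxy cxy; have := hB x y rxy cxy; rewrite !upE rxy.
  have := hA x; have := hA y; rewrite ?nE rxy => -[_ y1] [_ x1].
  case: (ltnP (T x) n) => Tx; case: (ltnP (T y) n) => Ty; do ?case: ifP; lia.
have upS (x : 'I_N) : (fill_strip T x < n.+1)%N = (col x < rowlen k (row x))%N.
  rewrite upE; have [] := hA x; rewrite ?nE => e _.
  case: ifP => Tx.
    rewrite ltnS (ltnW Tx); apply/esym; move: e; rewrite Tx => /esym h.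
    by apply: leq_trans h _; case/andP: (lk (row x)).
  by case: ifP => _; lia.
have shup : shape_below n (fill_strip T) = l.
  apply: (subshape_ext (sub_sh _ _) sl) => x.
  by rewrite -shP // uT; case: (hA x).
split=> //; apply/fillingsP; rewrite /= ?nE; split=> //.
- move=> x; rewrite /= ?nE upS; split=> //; rewrite upE; do 2?case: ifP; lia.
- move=> x y cxy rxy /=; rewrite ?nE upS => Ty.
  have h : (T x < n)%N.
    by have [-> _] := hA x; rewrite cxy; apply: leq_trans Ty _; exact: ncr.
  rewrite !upE h; case: (ltnP (T y) n) => Ty'; first exact: hC.
  by rewrite Ty.
move=> m; rewrite /= ltnS leq_eqVlt => /orP[/eqP mn|mn]; last first.
  rewrite subSS ?nE -(subnSK mn) /= -hD //; apply: eq_card => x.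
  rewrite !inE -!val_eqE /= upE; do 2?case: ifP; rewrite ?nE in mn *; lia.
rewrite mn subnn /=.
have := cardID [pred x | (T x < n)%N] [pred x : 'I_N | (col x < rowlen k (row x))%N].
rewrite card_subshape // -wlk -(card_subshape sl) => /eqP.
rewrite (_ : #|[predI _ & _]| = #|[pred x : 'I_N | (col x < rowlen l (row x))%N]|).
  rewrite eqn_add2l => /eqP <-; apply: eq_card => x.
  rewrite !inE -val_eqE /= mn upE ?nE; do 2?case: ifP; lia.
apply: eq_card => x; rewrite !inE; have [<- _] := hA x; rewrite ?nE andbC.
have [-> _] := hA x; apply: andb_idr => /leq_trans; apply.
by case/andP: (lk (row x)).
Qed.

Lemma card_fillings_cons :
  #|fillings k (a :: s)| =
  (\sum_(l : shape N | interlace l k && (weight l + a == weight k)) #|fillings l s|)%N.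
Proof.
rewrite -sum1_card (partition_big (shape_below n)
  (fun l : shape N => interlace l k && (weight l + a == weight k)%N) fillings_sh) /=.
apply: eq_bigr => l /andP[lk wl]; rewrite -sum1_card.
rewrite (reindex_onto fill_strip erase_strip) => [|T /andP[/down_fillings[]]//].
apply: eq_bigl => T; apply/andP/idP => [[/andP[/down_fillings[h _] /eqP e] /eqP d]|h].
  by rewrite e d in h.
by have [-> -> ->] := up_fillings lk wl h; rewrite !eqxx.
Qed.

End Peel.

Lemma card_fillings k s : subshape k -> (size s <= N)%N -> #|fillings k s| = chains s k.
Proof.
elim: s k => [|a s IH] k sk sN.
  have [k0|k0] := eqVneq (weight k) 0%N; last first.
    rewrite /= (negPf k0); apply: eq_card0 => T; apply/negP => /fillingsP[hA _ _ _].
    case/negP: k0; rewrite -(card_subshape sk); apply/eqP/eq_card0 => x.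
    by rewrite inE; have [<- _] := hA x.
  rewrite /= k0 eqxx; apply/eqP/cards1P; exists [ffun=> ord0]; apply/setP => T.
  rewrite inE; apply/fillingsP/eqP => [[hA _ _ _]|->].
    apply/ffunP => x; apply: val_inj; rewrite ffunE /=; have [_] := hA x.
    by rewrite leqn0 => /eqP.
  split=> // x; rewrite !ffunE //= ltn0; split=> //.
  by apply/esym/negbTE; rewrite -leqNgt (leq_trans (rowlen_le_weight _ _)) ?k0.
rewrite (@card_fillings_cons _ _ _ (size s)) //=; apply: eq_bigr => l /andP[lk _].
apply: IH; last exact: ltnW.
by move=> i; apply: leq_trans (sk i); case/andP: (interlaceP _ _ lk i).
Qed.

Definition part_shape : shape N := shape_of N (nth 0%N lam).

Lemma rowlen_part_shape i : rowlen part_shape i = nth 0%N lam i.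
Proof.
case: (leqP i N) => iN; first by apply: rowlen_shape_of => //; exact: intpart_leN.
by rewrite rowlen_ge // nth_default // (leq_trans size_intpart) // ltnW.
Qed.

Lemma card_ssyt (mu : seq nat) : #|ssyt N lam mu| = chains (rev (mkseq (nth 0%N mu) N)) part_shape.
Proof.
rewrite -card_fillings; last 2 first.
- by move=> i; rewrite rowlen_part_shape.
- by rewrite size_rev size_mkseq.
pose up (T : {ffun 'I_N -> 'I_N}) : {ffun 'I_N -> 'I_N.+1} := [ffun x => widen_ord (leqnSn N) (T x)].
(* All N boxes belong to the diagram of [lam], so the value N, the mark of an outside box, does not
   occur and the default of [insubd] is never reached. *)
pose down (T : {ffun 'I_N -> 'I_N.+1}) : {ffun 'I_N -> 'I_N} := [ffun x => insubd x (T x : nat)].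
have sz : size (rev (mkseq (nth 0%N mu) N)) = N by rewrite size_rev size_mkseq.
rewrite -!sum1_card (reindex_onto up down) => [|T /fillingsP[]]; last first.
  rewrite sz => hA _ _ _; apply/ffunP => x; apply: val_inj.
  rewrite !ffunE /= val_insubd.
  by have [->] := hA x; rewrite rowlen_part_shape col_lt.
apply: eq_bigl => T.
have -> : (down (up T) == T) = true.
  by apply/eqP/ffunP => x; apply: val_inj; rewrite !ffunE val_insubd /= ltn_ord.
have upE (x : 'I_N) : up T x = T x :> nat by rewrite ffunE.
have upm (m : 'I_N) (m' : 'I_N.+1) : m = m' :> nat -> #|[pred x | T x == m]| = #|[pred x | up T x == m']|.
  by move=> mm; apply: eq_card => x; rewrite !inE -!val_eqE /= upE mm.
rewrite andbT inE; apply/and3P/fillingsP; rewrite sz => -[].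
  move=> /forallP hB /forallP hC /forallP hD; split.
  - by move=> x; rewrite upE rowlen_part_shape col_lt ltn_ord; split=> //; exact: ltnW.
  - by move=> x y rxy cxy; rewrite !upE; have /forallP/(_ y)/implyP := hB x; apply; rewrite rxy eqxx.
  - by move=> x y cxy rxy _; rewrite !upE; have /forallP/(_ y)/implyP := hC x; apply; rewrite cxy eqxx.
  move=> m mN; rewrite -(upm (Ordinal mN)) // (eqP (hD _)) nth_rev size_mkseq.
    by rewrite subnS subKn // nth_mkseq.
  by rewrite subnSK ?leq_subr.
move=> hA hB hC hD; split.
- apply/forallP => x; apply/forallP => y; apply/implyP => /andP[/eqP rxy cxy].
  by have := hB x y rxy cxy; rewrite !upE.
- apply/forallP => x; apply/forallP => y; apply/implyP => /andP[/eqP cxy rxy].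
  by have := hC x y cxy rxy; rewrite !upE; apply.
apply/forallP => m; have mN : (widen_ord (leqnSn N) m < N)%N by exact: (ltn_ord m).
rewrite (upm m (widen_ord (leqnSn N) m)) // (hD _ mN) nth_rev size_mkseq.
  by rewrite subnS subKn //= nth_mkseq.
by rewrite subnSK ?leq_subr.
Qed.

End Tableaux.

(** * The Kostka matrix *)

(** Padded with zeros to N letters, and reversed because [chains] starts from the strip added
    last. *)
Definition weight_word (N : nat) (mu : seq nat) : seq nat := rev (mkseq (nth 0%N mu) N).

Definition dominates (lam mu : seq nat) :=
  forall j, (\sum_(i < j) nth 0 mu i <= \sum_(i < j) nth 0 lam i)%N.

Lemma size_weight_word N mu : size (weight_word N mu) = N.
Proof. by rewrite size_rev size_mkseq. Qed.

Lemma sumn_mkseq (f : nat -> nat) n : sumn (mkseq f n) = (\sum_(i < n) f i)%N.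
Proof.
rewrite sumnE big_map (_ : iota 0 n = index_iota 0 n) ?big_mkord //.
by rewrite /index_iota subn0.
Qed.

Lemma sum_nth_ge (s : seq nat) j : (size s <= j)%N -> (\sum_(i < j) nth 0 s i)%N = sumn s.
Proof.
move=> sj; rewrite -(big_mkord xpredT (nth 0%N s)) (big_cat_nat (leq0n (size s)) sj) /=.
rewrite -(big_nth 0%N xpredT id) -sumnE [X in (_ + X)%N]big1_seq ?addn0 // => i /=.
by rewrite mem_index_iota => /andP[si _]; rewrite nth_default.
Qed.

Lemma dominates_chains N lam mu : lam \in intparts N -> mu \in intparts N ->
  chains (weight_word N mu) (part_shape N lam) != 0%N -> dominates lam mu.
Proof.
move=> lN mN c j; case: (leqP j N) => jN; last first.
  rewrite !sum_nth_ge ?(sumn_intpart lN) ?(sumn_intpart mN) //.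
  - by apply: leq_trans (size_intpart lN) _; exact: ltnW.
  - by apply: leq_trans (size_intpart mN) _; exact: ltnW.
have := chains_dominance c; rewrite size_weight_word => /(_ j jN).
under [X in (_ <= X)%N -> _]eq_bigr do rewrite rowlen_part_shape //.
by rewrite /weight_word drop_rev size_mkseq subKn // sumn_rev -map_take take_iota
  (minn_idPl jN) sumn_mkseq.
Qed.

Lemma dominates_lexi N lam mu : mu \in intparts N -> dominates lam mu ->
  ((mu : seqlexi nat) <= lam)%O.
Proof.
rewrite mem_intparts => /and3P[_ z _].
elim: mu lam z => [|m mu IH] [|l lam] //=; rewrite inE negb_or => /andP[m0 z] dom.
  by have := dom 1%N; rewrite !big_ord1 /= leqn0 eq_sym (negPf m0).
rewrite lexi_cons; have := dom 1%N; rewrite !big_ord1 /= => ml.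
rewrite leEnat ml /=; apply/implyP => lm; apply: IH => // j.
have := dom j.+1; rewrite !big_ord_recl /=.
have -> : m = l by apply/eqP; rewrite eqn_leq ml.
by rewrite leq_add2l.
Qed.

Lemma dominates_antisym N lam mu : lam \in intparts N -> mu \in intparts N ->
  dominates lam mu -> dominates mu lam -> lam = mu.
Proof.
move=> lN mN lm ml; apply: (@le_anti _ (seqlexi nat)).
by rewrite (dominates_lexi lN ml) (dominates_lexi mN lm).
Qed.

Lemma mem_part N (I : 'I_(nparts N)) : part I \in intparts N.
Proof. exact: mem_nth. Qed.

Lemma part_inj N : injective (@part N).
Proof.
move=> I J /eqP; rewrite /part nth_uniq //; first by move/eqP/val_inj.
have := intparts_sorted N; apply: sorted_uniq => [y x z /= xy zy|x]; last by rewrite /= ltxx.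
exact: lt_trans zy xy.
Qed.

Lemma partP N lam : lam \in intparts N -> exists I : 'I_(nparts N), part I = lam.
Proof.
move=> lN; have h : (index lam (intparts N) < nparts N)%N by rewrite index_mem.
by exists (Ordinal h); rewrite /part nth_index.
Qed.

Lemma part_dominates_leq N (I J : 'I_(nparts N)) : dominates (part I) (part J) -> (I <= J)%N.
Proof.
move=> /(dominates_lexi (mem_part J)) le; rewrite leqNgt; apply/negP => JI.
have tr : transitive (fun p r : seqlexi nat => (r < p)%O).
  by move=> y x z /= yx zy; apply: lt_trans zy yx.
have := sorted_ltn_nth tr [::] (intparts_sorted N) J I (ltn_ord J) (ltn_ord I) JI.
by rewrite -/(part I) -/(part J) /= ltNge le.
Qed.

(** Truncation to the first rows gives the only chain: the shape before the last strip has at most j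
    rows, row i is at most [l i], and its weight is the sum of these bounds, so every bound is
    attained. *)
Lemma chains_diag N (l : nat -> nat) : (forall i j, (i <= j)%N -> (l j <= l i)%N) ->
  (forall i, (l i <= N)%N) ->
  forall j, (j <= N)%N ->
  chains (rev (mkseq l j)) (shape_of N (fun i => if (i < j)%N then l i else 0%N)) = 1%N.
Proof.
move=> mono lN; pose tr j := shape_of N (fun i => if (i < j)%N then l i else 0%N).
have trE j i : (j <= N)%N -> rowlen (tr j) i = if (i < j)%N then l i else 0%N.
  move=> jN; case: (leqP i N) => iN; first by rewrite rowlen_shape_of //; case: ifP.
  by rewrite rowlen_ge // ifF //; lia.
have trW j : (j <= N)%N -> weight (tr j) = (\sum_(i < j) l i)%N.
  move=> jN; rewrite /weight (big_ord_widen_cond N.+1 xpredT l) ?leqW //= [RHS]big_mkcond.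
  by apply: eq_bigr => i _; rewrite trE.
elim=> [_|j IH jN]; first by rewrite /= -/(tr 0%N) trW // big_ord0.
rewrite mkseqS rev_rcons [chains _ _]/= -/(tr j.+1).
have trI : interlace (tr j) (tr j.+1).
  apply/interlaceP => i; rewrite !trE //; last exact: ltnW.
  have := mono i i.+1 (leqnSn i); do ?case: ifP; lia.
rewrite (bigD1 (tr j)) /=; last first.
  by rewrite trI !trW // ?big_ord_recr //= ltnW.
rewrite (IH (ltnW jN)) [X in (_ + X)%N]big1 ?addn0 // => k /andP[/andP[/interlaceP kI /eqP kw] /eqP nk].
apply/eqP/negPn/negP => c; apply: nk.
have kj i : (j <= i)%N -> rowlen k i = 0%N.
  by move=> ji; apply: (chains_rows c); rewrite size_rev size_mkseq.
have kl i : (i < j)%N -> (rowlen k i <= l i)%N.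
  by move=> ij; have := kI i; rewrite !trE // (ltnW ij : (i < j.+1)%N) => /andP[].
have wk : weight k = (\sum_(i < j) rowlen k i)%N.
  rewrite [RHS](big_ord_widen _ (rowlen k) (leqW (ltnW jN))) [RHS]big_mkcond.
  by apply: eq_bigr => i _; case: ltnP => // /kj ->.
move: kw; rewrite trW // big_ord_recr /= wk => /addIn/eqP.
have /leqif_sum : forall i : 'I_j, true -> (rowlen k i <= l i ?= iff (rowlen k i == l i))%N.
  by move=> i _; split=> //; exact: kl.
move=> h; rewrite h => /forallP e.
apply: shapeP => i _; rewrite trE ?(ltnW jN) //; case: ltnP => ij; last exact: kj.
exact: (eqP (e (Ordinal ij))).
Qed.

Lemma kostkaE N (I J : 'I_(nparts N)) :
  kostka N I J = (chains (weight_word N (part J)) (part_shape N (part I)))%:Z.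
Proof. by rewrite mxE card_ssyt // mem_part. Qed.

Lemma kostka_diag N (I : 'I_(nparts N)) : kostka N I I = 1.
Proof.
rewrite kostkaE; congr (_%:Z); have IN := mem_part I.
rewrite -[RHS](@chains_diag N (nth 0%N (part I)) (intpart_nonincr IN) (intpart_leN IN) N (leqnn N)).
congr chains; apply: shapeP => i iN; rewrite rowlen_part_shape // rowlen_shape_of //.
  by case: ltnP => // Ni; rewrite nth_default // (leq_trans (size_intpart IN)).
by case: ifP => // _; exact: intpart_leN.
Qed.

Lemma kostka_dominates N (I J : 'I_(nparts N)) : kostka N I J != 0 -> dominates (part I) (part J).
Proof. by rewrite kostkaE => h; apply: dominates_chains (mem_part I) (mem_part J) h. Qed.

Lemma det_kostka N : \det (kostka N) = 1.
Proof.
rewrite -det_tr det_trig ?big1 // => [i _|]; first by rewrite mxE kostka_diag.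
apply/is_trig_mxP => i j ij; rewrite mxE; apply/eqP/negPn/negP.
by move=> /kostka_dominates/part_dominates_leq; rewrite leqNgt ij.
Qed.

(** * Permutation characters of the symmetric group *)

Section Contents.
Variables (N : nat) (T : finType).
Implicit Types (h g : {ffun 'I_N -> T}).

Definition content h : {ffun T -> 'I_N.+1} := [ffun t => inord #|[pred i | h i == t]|].

Lemma contentE h t : content h t = #|[pred i | h i == t]| :> nat.
Proof. by rewrite ffunE inordK // ltnS -[X in (_ <= X)%N]card_ord max_card. Qed.

Lemma sum_content h : (\sum_t content h t)%N = N.
Proof.
rewrite -[RHS]card_ord -sum1_card (partition_big h xpredT) //=.
by apply: eq_bigr => t _; rewrite contentE -sum1_card.
Qed.

Lemma count_content h t : count_mem t [tuple h i | i < N] = content h t.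
Proof.
rewrite contentE -sum1_card -sum1_count big_map big_enum_cond /=.
by apply: eq_bigl => i; rewrite inE.
Qed.

Lemma content_translate h g : (content g == content h) =
  [exists y : 'S_N, g == [ffun i => h (y i)]].
Proof.
apply/eqP/existsP => [e|[y /eqP->]].
  have p : perm_eq [tuple g i | i < N] [tuple h i | i < N].
    by apply/allP => t _ /=; rewrite !count_content e.
  have [y ey] := tuple_permP p; exists y; apply/eqP/ffunP => i.
  by have := congr1 (fun s => tnth s i) (val_inj ey); rewrite !tnth_mktuple ffunE.
apply/ffunP => t; apply: val_inj; rewrite /= !contentE.
rewrite -!sum1_card [RHS](reindex_inj (@perm_inj _ y)) /=.
by apply: eq_bigl => i; rewrite !inE ffunE.
Qed.

(** [enum_rank] turns letters into numbers, so that these groups are instances of [fiber_stab], like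
    the row stabilizers behind the irreducible characters. *)
Definition stab h : {set 'S_N} := fiber_stab (fun i => enum_rank (h i)).
Canonical stab_group h := [group of stab h].

Lemma mem_stab h (s : 'S_N) : (s \in stab h) = [forall i, h (s i) == h i].
Proof. by rewrite inE; apply: eq_forallb => i; rewrite (inj_eq val_inj) (inj_eq enum_rank_inj). Qed.

Lemma card_translator h (y0 : 'S_N) :
  #|[pred y : 'S_N | [ffun i => h (y i)] == [ffun i => h (y0 i)]]| = #|stab h|.
Proof.
rewrite -(card_lcoset (stab h) y0); apply: eq_card => y.
rewrite mem_lcoset mem_stab inE; apply/eqP/forallP => [e i|e].
  have /ffunP/(_ ((y0^-1)%g i)) := e; rewrite !ffunE permKV => <-.
  by rewrite permM.
apply/ffunP => i; rewrite !ffunE; have /eqP := e (y0 i).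
by rewrite permM permK.
Qed.

Lemma sum_translates (V : zmodType) h (F : {ffun 'I_N -> T} -> V) :
  \sum_(y : 'S_N) F [ffun i => h (y i)] =
  \sum_(g | content g == content h) F g *+ #|stab h|.
Proof.
rewrite (partition_big (fun y : 'S_N => [ffun i => h (y i)])
  (fun g => content g == content h)) /=; last first.
  by move=> y _; rewrite content_translate; apply/existsP; exists y.
apply: eq_bigr => g; rewrite content_translate => /existsP[y0 /eqP->].
rewrite -(card_translator h y0) -sumr_const; apply: eq_bigr => y.
by move=> /eqP->.
Qed.

Lemma card_content_class h :
  (#|[pred g | content g == content h]| * #|stab h| = N`!)%N.
Proof.
have := sum_translates h (fun=> 1 : int); rewrite !sumr_const card_Sn -mulrnA !natz => -[->].
by rewrite mulnC; congr (_ * _)%N; apply: eq_card.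
Qed.

Lemma content_surj (c : {ffun T -> 'I_N.+1}) : (\sum_t c t)%N = N -> exists h, content h = c.
Proof.
move=> cN; pose s := flatten [seq nseq (c t) t | t <- enum T].
have sN : size s == N.
  rewrite /s size_flatten /shape sumnE big_map big_map big_enum -[X in _ == X]cN /=.
  by apply/eqP/eq_bigr => t _; rewrite size_nseq.
exists [ffun i => tnth (Tuple sN) i]; apply/ffunP => t; apply: val_inj; rewrite /= -count_content.
have -> : [tuple [ffun i => tnth (Tuple sN) i] i | i < N] = Tuple sN.
  by apply: eq_from_tnth => i; rewrite tnth_mktuple ffunE.
rewrite /= count_flatten sumnE big_map big_map big_enum /= (bigD1 t) //= count_nseq /= eqxx mul1n.
by rewrite big1 ?addn0 // => t' /negPf tt; rewrite count_nseq /= tt.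
Qed.

(** The words of a given content form one orbit under permutation of the places, of size N! / |stab
    h|; each content thus collects the weight N!. *)
Lemma burnside (V : zmodType) (F : {ffun T -> 'I_N.+1} -> V) :
  \sum_h F (content h) *+ #|stab h| =
  \sum_(c : {ffun T -> 'I_N.+1} | (\sum_t c t)%N == N) F c *+ N`!.
Proof.
rewrite (partition_big content (fun c : {ffun T -> 'I_N.+1} => (\sum_t c t)%N == N)) /=; last first.
  by move=> h _; rewrite sum_content.
apply: eq_bigr => c /eqP/content_surj[h hc].
transitivity (\sum_(g | content g == content h) F (content h) *+ #|stab h|).
  rewrite hc; apply: eq_bigr => g /eqP gc; rewrite gc; congr (_ *+ _).
  have := card_content_class g; have := card_content_class h; rewrite gc hc => <- /eqP.
  rewrite eqn_pmul2l => [/eqP//|]; apply/card_gt0P; exists h; by rewrite inE hc.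
by rewrite sumr_const hc -mulrnA mulnC -hc card_content_class.
Qed.

Definition fixes h (s : 'S_N) := [forall i, h (s i) == h i].

(** This is the permutation character of the orbit of [h], which consists of the words with the same
    content; averaging over S_N meets each of them |stab h| times. *)
Lemma cfInd_stabE h (s : 'S_N) :
  'Ind[[set: 'S_N]] (1 : 'CF(stab h)) s =
  #|[pred g | (content g == content h) && fixes g s]|%:R.
Proof.
rewrite cfIndE; last exact: finset.subsetT.
transitivity (#|stab h|%:R^-1 * \sum_(y : 'S_N) (fixes [ffun i => h (y i)] s)%:R : algC).
  congr (_ * _); apply: eq_big => [y|y _]; first by rewrite inE.
  rewrite cfun1E mem_stab; congr (_ %:R); congr nat_of_bool; apply/forallP/forallP => H i.
    by have := H (y i); rewrite !ffunE !permM permK.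
  have := H ((y^-1)%g i); rewrite !ffunE permKV => /eqP e.
  by rewrite !permM e.
rewrite (sum_translates h (fun g => (fixes g s)%:R))
  sumrMnl -[X in _ * X = _]mulr_natl mulrA mulVf ?mul1r.
  rewrite -natr_sum -sum1_card; congr (_%:R); rewrite big_mkcond [RHS]big_mkcond.
  by apply: eq_bigr => g _; rewrite inE; case: (content g == content h); case: (fixes g s).
by rewrite pnatr_eq0 -lt0n cardG_gt0.
Qed.

End Contents.

(** * Inner products of permutation characters *)

Section Gram.
Variables (N : nat) (T T' : finType).
Implicit Types (h : {ffun 'I_N -> T}) (g : {ffun 'I_N -> T'}).

Definition ffun_pair h g : {ffun 'I_N -> T * T'} := [ffun i => (h i, g i)].

Lemma ffun_pair_bij : bijective (fun p => ffun_pair p.1 p.2).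
Proof.
exists (fun k : {ffun 'I_N -> T * T'} => ([ffun i => (k i).1], [ffun i => (k i).2])) => [[h g]|k] /=.
  by congr pair; apply/ffunP => i; rewrite !ffunE.
by apply/ffunP => i; rewrite !ffunE -surjective_pairing.
Qed.

Lemma fixes_pair h g s : fixes (ffun_pair h g) s = fixes h s && fixes g s.
Proof.
apply/forallP/andP => [H|[/forallP hs /forallP gs] i].
  by split; apply/forallP => i; have := H i; rewrite !ffunE xpair_eqE => /andP[].
by rewrite !ffunE xpair_eqE hs gs.
Qed.

Definition has_margins h g (c : {ffun T * T' -> 'I_N.+1}) :=
  [forall t, (\sum_t' c (t, t') == content h t)%N] &&
  [forall t', (\sum_t c (t, t') == content g t')%N].

Lemma content_pair h g h0 g0 :
  has_margins h0 g0 (content (ffun_pair h g)) = (content h == content h0) && (content g == content g0).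
Proof.
have E1 t : (\sum_t' content (ffun_pair h g) (t, t'))%N = content h t.
  rewrite contentE -sum1_card (partition_big g xpredT) //=; apply: eq_bigr => t' _.
  by rewrite contentE -sum1_card; apply: eq_bigl => i; rewrite !inE ffunE xpair_eqE.
have E2 t' : (\sum_t content (ffun_pair h g) (t, t'))%N = content g t'.
  rewrite contentE -sum1_card (partition_big h xpredT) //=; apply: eq_bigr => t _.
  by rewrite contentE -sum1_card; apply: eq_bigl => i; rewrite !inE ffunE xpair_eqE andbC.
congr (_ && _); apply/forallP/eqP => [H|H t]; rewrite ?E1 ?E2 ?H //.
  by apply/ffunP => t; apply: val_inj; have /eqP := H t; rewrite E1.
by apply/ffunP => t; apply: val_inj; have /eqP := H t; rewrite E2.
Qed.

(** The product of the two characters counts the fixed pairs of words. A pair is one word in the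
    letters [T * T'], and its content is a matrix whose margins are the contents of the two words;
    [burnside] then counts each such matrix once. *)
Lemma cfdot_Ind_stab h g :
  '['Ind[[set: 'S_N]] (1 : 'CF(stab h)), 'Ind[[set: 'S_N]] (1 : 'CF(stab g))] =
  #|[set c | has_margins h g c]|%:R.
Proof.
rewrite cfdotE cardsT card_Sn.
have -> : \sum_(s in [set: 'S_N]) 'Ind[[set: 'S_N]] (1 : 'CF(stab h)) s *
    ('Ind[[set: 'S_N]] (1 : 'CF(stab g)) s)^* =
  \sum_(k : {ffun 'I_N -> T * T'}) (has_margins h g (content k))%:R *+ #|stab k| :> algC.
  transitivity (\sum_(s : 'S_N) \sum_(k : {ffun 'I_N -> T * T'})
     (has_margins h g (content k) && fixes k s)%:R : algC).
    apply: eq_big => [s|s _]; first by rewrite inE.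
    rewrite !cfInd_stabE conjC_nat -natrM.
    rewrite (reindex _ (onW_bij _ ffun_pair_bij)) /= -natr_sum; congr (_%:R).
    rewrite -(pair_bigA _ (fun h' g' => (has_margins h g (content (ffun_pair h' g'))
      && fixes (ffun_pair h' g') s) : nat)) /=.
    rewrite -!sum1_card big_distrl /= big_mkcond; apply: eq_bigr => h' _.
    rewrite inE; case: ifP => [H|/negbT H]; last first.
      by rewrite big1 // => g' _; rewrite content_pair fixes_pair andbACA (negPf H).
    rewrite mul1n big_mkcond; apply: eq_bigr => g' _.
    by rewrite content_pair fixes_pair andbACA H inE /=; case: ifP.
  rewrite exchange_big; apply: eq_bigr => k _.
  rewrite -sumr_const -natr_sum -[RHS]natr_sum; congr (_%:R).
  rewrite [RHS]big_mkcond; apply: eq_bigr => s _; rewrite mem_stab -/(fixes k s).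
  by case: (has_margins _ _ _); case: (fixes k s).
rewrite (burnside (fun c => (has_margins h g c)%:R))
  sumrMnl -[X in _ * X]mulr_natl mulrA mulVf ?mul1r; last first.
  by rewrite pnatr_eq0 -lt0n fact_gt0.
rewrite -natr_sum -sum1_card; congr (_%:R); rewrite big_mkcond [RHS]big_mkcond.
apply: eq_bigr => c _; rewrite inE; case: ifP => [|/negbT cN]; first by case: ifP.
(* [burnside] only ranges over total content N, but the margins already impose this total. *)
rewrite ifF //; apply/negP => /andP[/forallP H _]; case/negP: cN.
have -> : (\sum_p c p = \sum_t \sum_t' c (t, t'))%N.
  by rewrite pair_bigA; apply: eq_bigr => -[].
rewrite -[X in _ == X](sum_content h); by apply/eqP/eq_bigr => t _; apply/eqP.
Qed.

End Gram.

Definition content_word N n (h : {ffun 'I_N -> 'I_n}) : seq nat :=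
  [seq (content h i : nat) | i <- enum 'I_n].

Lemma sumn_content_word N n (h : {ffun 'I_N -> 'I_n}) : sumn (content_word h) = N.
Proof. by rewrite sumnE big_map big_enum /= sum_content. Qed.

Lemma size_content_word N n (h : {ffun 'I_N -> 'I_n}) : size (content_word h) = n.
Proof. by rewrite size_map size_enum_ord. Qed.

Lemma cfdot_Ind_stab_chains N m n (h : {ffun 'I_N -> 'I_m}) (g : {ffun 'I_N -> 'I_n}) :
  (m <= N)%N ->
  '['Ind[[set: 'S_N]] (1 : 'CF(stab h)), 'Ind[[set: 'S_N]] (1 : 'CF(stab g))] =
  (\sum_(v : shape N) chains (content_word h) v * chains (content_word g) v)%N%:R.
Proof.
move=> mN; rewrite cfdot_Ind_stab sum_chains_mul ?size_content_word ?sumn_content_word //.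
by rewrite -(card_margin_matrices (N := N)) // => i; rewrite -ltnS.
Qed.

Lemma chains_nonincr N s (v : shape N) i : chains s v != 0%N -> (rowlen v i.+1 <= rowlen v i)%N.
Proof.
case: s => [|a s] /=.
  by rewrite weight_eq0; case: (v =P _) => // -> _; rewrite !rowlen0.
rewrite sum_nat_eq0 negb_forall => /existsP[k]; rewrite negb_imply.
by case/andP => /andP[/interlaceP/(_ i)/andP[h1 h2] _] _; apply: leq_trans h1 h2.
Qed.

Lemma chains_shape N s (v : shape N) : sumn s = N -> chains s v != 0%N ->
  exists I : 'I_(nparts N), v = part_shape N (part I).
Proof.
move=> sN c; have mono i j : (i <= j)%N -> (rowlen v j <= rowlen v i)%N.
  elim: j => [|j IH]; first by rewrite leqn0 => /eqP->.
  rewrite leq_eqVlt => /orP[/eqP->//|]; rewrite ltnS => /IH; apply: leq_trans.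
  exact: chains_nonincr c.
have ex : exists i, rowlen v i == 0%N by exists N.+1; rewrite rowlen_ge.
case: (ex_minnP ex) => k /eqP k0 kmin.
have vk i : (k <= i)%N -> rowlen v i = 0%N by move=> /mono; rewrite k0 leqn0 => /eqP.
have nthv i : nth 0%N (mkseq (rowlen v) k) i = rowlen v i.
  case: (ltnP i k) => ik; first by rewrite nth_mkseq.
  by rewrite nth_default ?size_mkseq // vk.
have lN : mkseq (rowlen v) k \in intparts N.
  rewrite mem_intparts; apply/and3P; split.
  - rewrite sorted_map; apply: sub_sorted (iota_sorted 0 k) => i j /=; exact: mono.
  - by apply/negP => /mapP[i]; rewrite mem_iota /= add0n => ik /esym/eqP/kmin; rewrite leqNgt ik.
  rewrite -[X in _ == X]sN -(chains_weight c) sumn_mkseq /weight.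
  rewrite -(big_mkord xpredT (rowlen v)) -(big_mkord xpredT (rowlen v)).
  have kN : (k <= N.+1)%N by apply: kmin; rewrite rowlen_ge.
  rewrite (big_cat_nat (leq0n k) kN) /= [X in (_ + X)%N]big1_seq ?addn0 // => i /=.
  by rewrite mem_index_iota => /andP[/vk].
have [I IE] := partP lN; exists I; apply: shapeP => i _.
by rewrite rowlen_part_shape ?mem_part // IE nthv.
Qed.

Lemma sum_chains_parts N s (F : shape N -> nat) : sumn s = N ->
  (\sum_(v : shape N) chains s v * F v =
   \sum_(I < nparts N) chains s (part_shape N (part I)) * F (part_shape N (part I)))%N.
Proof.
move=> sN.
have inj : injective (fun I : 'I_(nparts N) => part_shape N (part I)).
  move=> I J e; apply: part_inj; apply: (@dominates_antisym N); rewrite ?mem_part //.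
    by move=> j; apply: leq_sum => i _; rewrite -!(rowlen_part_shape (mem_part _)) e.
  by move=> j; apply: leq_sum => i _; rewrite -!(rowlen_part_shape (mem_part _)) e.
rewrite (bigID (mem [set part_shape N (part I) | I in 'I_(nparts N)])) /=.
rewrite [X in (_ + X)%N]big1 ?addn0 => [|v vI].
  by rewrite big_imset //= => I J _ _; exact: inj.
case: (eqVneq (chains s v) 0%N) => [->//|/(chains_shape sN)[I e]].
by case/negP: vI; rewrite e; apply/imsetP; exists I.
Qed.

Section RowFun.
Variables (N : nat) (lam : seq nat).
Hypothesis lamN : lam \in intparts N.

Lemma row_ltN (x : 'I_N) : (row_of lam x < N)%N.
Proof. exact: leq_trans (row_lt lamN x) (size_intpart lamN). Qed.

(** The row index is reversed to match [weight_word], where the last row comes first. *)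
Definition row_fun : {ffun 'I_N -> 'I_N} := [ffun x => rev_ord (Ordinal (row_ltN x))].

Lemma card_row r : #|[pred x : 'I_N | row_of lam x == r]| = nth 0%N lam r.
Proof.
case: (leqP r N) => rN; last first.
  rewrite nth_default ?(leq_trans (size_intpart lamN)) //; last exact: ltnW.
  by apply: eq_card0 => x; rewrite inE; apply/negP => /eqP e; have := row_ltN x; rewrite e; lia.
have := card_boxes lamN (k := fun i => if i == r then nth 0%N lam r else 0%N).
rewrite (bigD1 (Ordinal (rN : (r < N.+1)%N))) //= eqxx big1 ?addn0 => [<-|i].
- by apply: eq_card => x; rewrite !inE; case: eqP => // <-; rewrite col_lt.
- by move=> i; case: eqP => // ->.
by rewrite -val_eqE /= => /negPf ->.
Qed.

Lemma content_row_fun : content_word row_fun = weight_word N lam.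
Proof.
apply: (@eq_from_nth _ 0%N) => [|i]; first by rewrite size_content_word size_weight_word.
rewrite size_content_word => iN; rewrite (nth_map (Ordinal iN)) ?size_enum_ord //.
rewrite (nth_ord_enum _ (Ordinal iN)) contentE nth_rev size_mkseq // nth_mkseq; last by lia.
rewrite -card_row; apply: eq_card => x; rewrite !inE ffunE -val_eqE /=.
by have := row_ltN x; lia.
Qed.

Lemma stab_row_fun : stab row_fun = fiber_stab (fun x : 'I_N => row_of lam x).
Proof.
apply/setP => s; rewrite mem_stab inE; apply: eq_forallb => x.
by rewrite !ffunE (inj_eq rev_ord_inj) -val_eqE.
Qed.

End RowFun.

(** * The irreducible characters *)

Section SchurCharacter.
Variable N : nat.
Local Notation SN := [set: 'S_N]%G.
Implicit Types I J K L : 'I_(nparts N).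

Definition part_row I : {ffun 'I_N -> 'I_N} := row_fun (mem_part I).

Definition young_cf I : 'CF([set: 'S_N]) := 'Ind (1 : 'CF(stab (part_row I))).

Definition schur_cf I : 'CF([set: 'S_N]) :=
  \sum_L (inv_kostka N L I)%:~R *: young_cf L.

Lemma kostka_unit : kostka N \in unitmx.
Proof. by rewrite unitmxE det_kostka unitr1. Qed.

Lemma kostka_chains I J :
  kostka N I J = (chains (content_word (part_row J)) (part_shape N (part I)))%:Z.
Proof. by rewrite kostkaE content_row_fun. Qed.

Lemma cfdot_young_Ind n (h : {ffun 'I_N -> 'I_n}) L :
  '[young_cf L, 'Ind[[set: 'S_N]] (1 : 'CF(stab h))] =
  \sum_K (kostka N K L)%:~R * (chains (content_word h) (part_shape N (part K)))%:R.
Proof.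
rewrite cfdot_Ind_stab_chains // sum_chains_parts ?sumn_content_word // natr_sum.
by apply: eq_bigr => K _; rewrite natrM kostka_chains.
Qed.

Lemma mulr_kostkaV (R : pzRingType) K I :
  \sum_L (kostka N K L)%:~R * (inv_kostka N L I)%:~R = (K == I)%:R :> R.
Proof.
have := congr1 (fun M : 'M[int]_(nparts N) => (M K I)%:~R : R) (mulmxV kostka_unit).
rewrite !mxE rmorph_sum /= => e; under eq_bigr do rewrite -intrM; rewrite e.
by case: eqP.
Qed.

Lemma mulrV_kostka (R : pzRingType) L J :
  \sum_I (inv_kostka N L I)%:~R * (kostka N I J)%:~R = (L == J)%:R :> R.
Proof.
have := congr1 (fun M : 'M[int]_(nparts N) => (M L J)%:~R : R) (mulVmx kostka_unit).
rewrite !mxE rmorph_sum /= => e; under eq_bigr do rewrite -intrM; rewrite e.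
by case: eqP.
Qed.

Lemma sum_delta (V : lmodType algC) (F : 'I_(nparts N) -> V) I :
  \sum_K (K == I)%:R *: F K = F I.
Proof.
rewrite (bigD1 I) //= eqxx scale1r big1 ?addr0 // => K /negPf->.
by rewrite scale0r.
Qed.

(** The pairings with the [young_cf L] carry a factor K^T, which the inverse Kostka coefficients
    cancel. The alphabet of [h] is left free because its letters will be the energy levels. *)
Lemma cfdot_schur_Ind n (h : {ffun 'I_N -> 'I_n}) I :
  '[schur_cf I, 'Ind[[set: 'S_N]] (1 : 'CF(stab h))] =
  (chains (content_word h) (part_shape N (part I)))%:R.
Proof.
rewrite cfdot_suml; pose F K : algC^o := (chains (content_word h) (part_shape N (part K)))%:R.
rewrite -[RHS]/(F I) -(sum_delta F).
under eq_bigr => L _ do rewrite cfdotZl cfdot_young_Ind big_distrr /=.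
rewrite exchange_big; apply: eq_bigr => K _; rewrite -mulr_kostkaV scaler_suml.
by apply: eq_bigr => L _; rewrite mulrCA mulrA.
Qed.

Lemma cfdot_schur_young I J : '[schur_cf I, young_cf J] = (kostka N I J)%:~R.
Proof. by rewrite cfdot_schur_Ind kostka_chains. Qed.

Lemma cfdot_schur I J : '[schur_cf I, schur_cf J] = (I == J)%:R.
Proof.
rewrite cfdot_sumr.
rewrite -mulr_kostkaV; apply: eq_bigr => L _.
by rewrite cfdotZr cfdot_schur_young (conj_intr (intr_int _ _)) mulrC.
Qed.

Lemma young_schur J : young_cf J = \sum_I (kostka N I J)%:~R *: schur_cf I.
Proof.
rewrite -[LHS](sum_delta young_cf); under [RHS]eq_bigr do rewrite scaler_sumr.
rewrite [RHS]exchange_big; apply: eq_bigr => L _; rewrite -mulrV_kostka scaler_suml.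
by apply: eq_bigr => I _; rewrite scalerA mulrC.
Qed.

Lemma young_char J : young_cf J \is a character.
Proof. by rewrite cfInd_char ?cfun1_char. Qed.

Lemma schur_irr I : exists i, schur_cf I = 'chi_i.
Proof.
have v : schur_cf I \in ('Z[irr SN])%g.
  rewrite rpred_sum // => L _; apply: scale_zchar; first exact: rpred_int.
  exact: char_vchar (young_char L).
have [b [i e]] := vchar_norm1P v (etrans (cfdot_schur I I) (f_equal (fun b : bool => b%:R) (eqxx I))).
exists i; case: b e => e; last by rewrite e expr0 scale1r.
have : 0 <= '['chi_i, young_cf I] by rewrite natr_ge0 ?Cnat_cfdot_char ?irr_char ?young_char.
have := cfdot_schur_young I I; rewrite e kostka_diag /= scaleN1r cfdotNl => /eqP.
by rewrite eqr_oppLR => /eqP->; rewrite oppr_ge0 lern0.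
Qed.

Lemma schur_int I s : schur_cf I s \in Num.int.
Proof.
rewrite sum_cfunE rpred_sum // => L _; rewrite cfunE rpredM ?rpred_int //.
by rewrite cfInd_stabE rpred_nat.
Qed.

End SchurCharacter.

(** * Characters induced from the sign of a column stabilizer *)

Section SignInduction.
Variables (N : nat) (c : 'I_N -> nat) (T : finType).
Implicit Types g h : {ffun 'I_N -> T}.

(* A transposition in the intersection of the two stabilizers makes the
   signs cancel; without one the intersection is trivial. *)
Lemma sum_sign g :
  \sum_(s : 'S_N | (s \in fiber_stab c) && fixes g s) (-1) ^+ s =
  (injectiveb (fun x => (c x, g x)))%:R :> algC.
Proof.
case: injectiveP => [inj|ninj].
  rewrite (big_pred1 1%g) ?odd_perm1 // => s /=; apply/andP/eqP => [[]|->].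
    rewrite inE => /forallP cs /forallP gs; apply/permP => x; rewrite perm1.
    by apply: inj; rewrite (eqP (cs x)) (eqP (gs x)).
  by rewrite group1; split=> //; apply/forallP => x; rewrite perm1.
have [x [y [cxy gxy xy]]] : exists x y, [/\ c x = c y, g x = g y & x != y].
  apply: contrapT => h; apply: ninj => x y [cxy gxy]; apply/eqP/negPn/negP => xy.
  by apply: h; exists x, y.
set S := \sum_(s | _) _; suff : S = - S by move/eqP; rewrite -addr_eq0 -mulr2n mulrn_eq0 => /eqP.
rewrite {1}/S (reindex_inj (mulgI (tperm x y))) /= -sumrN; apply: eq_big => [s|s _]; last first.
  by rewrite odd_mul_tperm xy signr_addb expr1 mulN1r.
have tE (U : Type) (f : 'I_N -> U) z : f x = f y -> f (tperm x y z) = f z.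
  by move=> fxy; case: tpermP => [->|->|].
rewrite !inE; congr (_ && _); apply/forallP/forallP => H z.
- by have := H (tperm x y z); rewrite permM tpermK tE.
- by rewrite permM -(tE _ c z cxy).
- by have := H (tperm x y z); rewrite permM tpermK tE.
- by rewrite permM -(tE _ g z gxy).
Qed.

Lemma sgn_charE (s : 'S_N) : sgn_char N s = (-1) ^+ s.
Proof. by rewrite /sgn_char cfunE. Qed.

(** Frobenius reciprocity leaves the mean over [fiber_stab c] of the sign times the number of fixed
    words. By [sum_sign] only words that repeat no letter within a fibre of [c] survive. *)
Lemma cfdot_Ind_sgn h :
  '['Ind[[set: 'S_N]] ('Res[fiber_stab c] (sgn_char N)), 'Ind (1 : 'CF(stab h))] =
  #|fiber_stab c|%:R^-1 *
  #|[pred g | (content g == content h) && injectiveb (fun x => (c x, g x))]|%:R.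
Proof.
have sub : fiber_stab c \subset [set: 'S_N] by exact: finset.subsetT.
rewrite -cfdot_Res_r cfdotE; congr (_ * _).
transitivity (\sum_(s in fiber_stab c) \sum_(g | content g == content h)
  (-1) ^+ s * (fixes g s)%:R : algC).
  apply: eq_bigr => s sC; rewrite !cfResE // sgn_charE cfInd_stabE conjC_nat -big_distrr /=.
  rewrite -natr_sum -sum1_card; congr (_ * _%:R); rewrite big_mkcond [RHS]big_mkcond.
  by apply: eq_bigr => g _; rewrite inE; case: (content g == content h); case: (fixes g s).
rewrite exchange_big /= -sum1_card natr_sum.
rewrite [RHS](eq_bigl _ _ (fun g => erefl (g \in _))).
rewrite big_mkcond [RHS]big_mkcond; apply: eq_bigr => g _; rewrite inE.
case: (content g == content h) => //=.
transitivity (\sum_(s : 'S_N | (s \in fiber_stab c) && fixes g s) (-1) ^+ s : algC).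
  rewrite [RHS]big_mkcondr; apply: eq_bigr => s _.
  by case: (fixes g s); rewrite ?mulr1 ?mulr0.
by rewrite sum_sign; case: injectiveb.
Qed.

End SignInduction.

Lemma card_lt_sum (T : finType) (f : T -> nat) j :
  #|[pred x | (f x < j)%N]| = (\sum_(i < j) #|[pred x | f x == i]|)%N.
Proof.
elim: j => [|j IH]; first by rewrite big_ord0; apply: eq_card0 => x; rewrite inE ltn0.
rewrite big_ord_recr /= -IH -[LHS](cardID [pred x | (f x < j)%N]); congr addn; apply: eq_card => x;
  rewrite !inE; lia.
Qed.

Section Columns.
Variables (N : nat) (lam mu : seq nat).
Hypotheses (lamN : lam \in intparts N) (muN : mu \in intparts N).

(** The easy half of the Gale-Ryser theorem, column by column: since a column repeats no letter, the
    number of its boxes filled with j chosen letters is at most the number of its boxes in the first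
    j rows. *)
Lemma dominates_columns (g : {ffun 'I_N -> 'I_N}) :
  content g = content (row_fun muN) -> injective (fun x : 'I_N => (col_of lam x, g x)) ->
  dominates lam mu.
Proof.
move=> cg inj j; pose r x : nat := rev_ord (g x).
have rmu i : #|[pred x | r x == i]| = nth 0%N mu i.
  rewrite -(card_row muN); case: (ltnP i N) => iN; last first.
    rewrite !eq_card0 // => x; rewrite inE; apply/negP => /eqP e.
      by have := row_ltN muN x; rewrite e ltnNge iN.
    by have := ltn_ord (rev_ord (g x)); rewrite -/(r x) e ltnNge iN.
  have := congr1 (fun f : {ffun 'I_N -> 'I_N.+1} => f (rev_ord (Ordinal iN)) : nat) cg.
  rewrite /= !contentE => e; transitivity #|[pred i0 | g i0 == rev_ord (Ordinal iN)]|.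
    apply: eq_card => x; rewrite !inE -(inj_eq rev_ord_inj) rev_ordK.
    by rewrite -val_eqE.
  rewrite e; apply: eq_card => x; rewrite !inE ffunE (inj_eq rev_ord_inj).
  by rewrite -val_eqE.
under eq_bigr do rewrite -rmu; under [X in (_ <= X)%N]eq_bigr do rewrite -(card_row lamN).
rewrite -!card_lt_sum.
have colN (x : 'I_N) : (col_of lam x < N)%N.
  exact: leq_trans (col_lt lamN x) (intpart_leN lamN _).
have split (q : pred 'I_N) : #|q| = (\sum_(c < N) #|[pred x | q x & col_of lam x == c]|)%N.
  rewrite -sum1_card (partition_big (fun x => Ordinal (colN x)) xpredT) //=.
  by apply: eq_bigr => c _; rewrite -sum1_card; apply: eq_bigl => x; rewrite !inE -val_eqE.
rewrite split [X in (_ <= X)%N]split; apply: leq_sum => c _ /=.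
set A := [pred x | _]; set B := [pred x | _].
(* A column reaching row j has j boxes above that row, and at most j boxes with the chosen letters;
   a shorter column lies entirely in the first j rows. *)
case: (boolP [exists y : 'I_N, (col_of lam y == c) && (j <= row_of lam y)%N]) =>
  [/existsP[y /andP[/eqP yc jy]]|ney].
  apply: (@leq_trans j).
    rewrite cardE -(size_map r) -[X in (_ <= X)%N](size_iota 0); apply: uniq_leq_size.
      rewrite map_inj_in_uniq ?enum_uniq // => x x'; rewrite !mem_enum !inE.
      move=> /andP[_ /eqP cx] /andP[_ /eqP cx'] /val_inj/rev_ord_inj e; apply: inj.
      by rewrite cx cx' e.
    by move=> _ /mapP[x + ->]; rewrite mem_enum mem_iota inE => /andP[].
  rewrite (cardE B) -(size_map (fun x : 'I_N => row_of lam x)) -[X in (X <= _)%N](size_iota 0).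
  apply: uniq_leq_size; first exact: iota_uniq.
  move=> i; rewrite mem_iota add0n /= => ij; apply/mapP.
  have ci : (c < nth 0%N lam i)%N.
    by rewrite -yc; apply: leq_trans (col_lt lamN y) _; apply: intpart_nonincr lamN _ _ _; lia.
  have [x [xr xc]] := box_ex lamN ci.
  by exists x => //; rewrite mem_enum inE /= xr xc ij eqxx.
apply/subset_leq_card/fintype.subsetP => x; rewrite !inE => /andP[_ xc]; rewrite xc andbT ltnNge.
by apply/negP => jx; case/negP: ney; apply/existsP; exists x; rewrite xc.
Qed.

End Columns.

Section SymChar.
Variable N : nat.
Local Notation SN := [set: 'S_N]%G.
Implicit Types I J K L : 'I_(nparts N).

Lemma sgn_char_char : sgn_char N \is a character.
Proof.
pose f (s : 'S_N) : 'M[algC]_1 := ((-1) ^+ s)%:M.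
have fP : mx_repr SN f.
  by split=> [|s t _ _]; rewrite /f ?odd_perm1 // odd_permM signr_addb scalar_mxM.
have -> : sgn_char N = cfRepr (MxRepresentation fP); last exact: cfRepr_char.
by apply/cfunP => s; rewrite sgn_charE cfunE inE mulr1n /= mxtrace_scalar.
Qed.

(** The multiplicities of characters are nonnegative, so nothing cancels in the inner product. *)
Lemma common_constituent_cfdot (phi psi : 'CF(SN)) :
  phi \is a character -> psi \is a character ->
  ('[phi, psi] != 0) <-> exists i, (i \in irr_constt phi) && (i \in irr_constt psi).
Proof.
move=> cphi cpsi; rewrite cfdot_sum_irr psumr_neq0 => [|i _]; last first.
  by rewrite mulr_ge0 ?conjC_ge0 ?natr_ge0 ?Cnat_cfdot_char_irr.
split=> [/hasP[i _]|[i /andP[i1 i2]]].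
  rewrite lt_def mulf_eq0 conjC_eq0 negb_or /= => /andP[/andP[i1 i2] _].
  by exists i; rewrite !irr_consttE i1.
apply/hasP; exists i; rewrite ?mem_index_enum //= lt_def mulf_eq0 conjC_eq0 negb_or -!irr_consttE i1 i2.
by rewrite mulr_ge0 ?conjC_ge0 ?natr_ge0 ?Cnat_cfdot_char_irr.
Qed.

Lemma irr_constt_young I i : i \in irr_constt (young_cf I) ->
  exists2 K, 'chi_i = schur_cf K & dominates (part K) (part I).
Proof.
rewrite irr_consttE young_schur cfdot_suml => h.
have [K nK] : exists K, '[(kostka N K I)%:~R *: schur_cf K, 'chi_i] != 0.
  apply: contrapT => hK; case/eqP: h; apply: big1 => K _.
  by apply/eqP/negPn/negP => nK; apply: hK; exists K.
move: nK; rewrite cfdotZl mulf_eq0 negb_or intr_eq0 => /andP[k0].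
have [k kE] := schur_irr K; rewrite kE cfdot_irr.
case: (k =P i) => [<- _|_]; last by rewrite eqxx.
by exists K => //; exact: kostka_dominates.
Qed.

Lemma Ind_cfun1_eq (A B : {group 'S_N}) : A = B :> {set 'S_N} ->
  'Ind[SN] (1 : 'CF(A)) = 'Ind[SN] (1 : 'CF(B)).
Proof. by move=> /group_inj->. Qed.

Lemma Ind_row_stab I :
  'Ind[SN] (1 : 'CF(fiber_stab (fun x : 'I_N => row_of (part I) x))) = young_cf I.
Proof. by apply: Ind_cfun1_eq; rewrite /= stab_row_fun. Qed.

Definition column_sgn I : 'CF(SN) :=
  'Ind ('Res[fiber_stab (fun x => col_of (part I) x)] (sgn_char N)).

Lemma column_sgn_char I : column_sgn I \is a character.
Proof. by rewrite cfInd_char ?cfRes_char ?sgn_char_char. Qed.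

(** The row function itself is a surviving word, since a box is determined by its row and column. *)
Lemma cfdot_column_sgn I : '[column_sgn I, young_cf I] != 0.
Proof.
rewrite cfdot_Ind_sgn mulf_neq0 ?invr_eq0 ?pnatr_eq0 -?lt0n ?cardG_gt0 //.
apply/card_gt0P; exists (part_row I); rewrite inE eqxx; apply/injectiveP => x y [cxy].
rewrite /part_row !ffunE => /rev_ord_inj/(congr1 val) /= rxy.
exact: box_inj rxy cxy.
Qed.

(** Occurring in [young_cf I], the constituent is [schur_cf K] with K dominating I. By the unit
    diagonal it also occurs in [young_cf K], so [column_sgn I] and [young_cf K] are not orthogonal,
    and this makes I dominate K. *)
Lemma common_constituent_schur I i : common_constituent (part I) i -> 'chi_i = schur_cf I.
Proof.
move=> /andP[]; rewrite Ind_row_stab => iy ic.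
have [K iK KI] := irr_constt_young iy; rewrite iK.
have : '[column_sgn I, young_cf K] != 0.
  apply/(common_constituent_cfdot (column_sgn_char I) (young_char K)); exists i.
  rewrite ic irr_consttE cfdotC conjC_eq0 iK cfdot_schur_young kostka_diag.
  by rewrite rmorph1 oner_neq0.
rewrite cfdot_Ind_sgn mulf_eq0 negb_or pnatr_eq0 -lt0n => /andP[_ /card_gt0P[g]].
rewrite inE => /andP[/eqP cg /injectiveP inj].
have IK := dominates_columns (mem_part I) cg inj.
by rewrite (part_inj (dominates_antisym (mem_part I) (mem_part K) IK KI)).
Qed.

(** The default index 0 is never taken: a nonzero inner product provides a common constituent. *)
Lemma sym_charE I : sym_char N (part I) = schur_cf I.
Proof.
rewrite /sym_char; case: pickP => [i /common_constituent_schur//|none].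
have /(common_constituent_cfdot (column_sgn_char I)
  (young_char I))[i /andP[i1 i2]] := cfdot_column_sgn I.
have := none i; rewrite /common_constituent i1 andbT.
by rewrite Ind_row_stab i2.
Qed.

End SymChar.

(** * Class sizes *)

Section FixedFunctions.
Variables (N : nat) (T : finType) (t0 : T).
Implicit Types (h : {ffun 'I_N -> T}) (s : 'S_N).

Lemma fixes_porbit h s x y : fixes h s -> y \in porbit s x -> h y = h x.
Proof.
move=> /forallP hs /porbitP[i ->]; elim: i => [|i IH]; first by rewrite expg0 perm1.
by rewrite expgSr permM (eqP (hs _)).
Qed.

Lemma card_porbit_class s X : X \in porbits s -> #|[pred x | porbit s x == X]| = #|X|.
Proof.
case/imsetP => x0 _ ->; apply: eq_card => x; rewrite inE.
by rewrite eq_porbit_mem porbit_sym.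
Qed.

Lemma prod_cycle_type (R : comPzRingType) s (F : nat -> R) :
  \prod_(m <- cycle_type s) F m = \prod_(X in porbits s) F #|X|.
Proof.
rewrite (perm_big _ (permEl (perm_sort _ _))) /= big_map big_enum /=.
by [].
Qed.

(* A function fixed by [s] is a function on the cycles of [s]. *)
Lemma sum_fixes (R : comPzRingType) s (z : T -> R) :
  \sum_(h | fixes h s) \prod_i z (h i) = \prod_(m <- cycle_type s) \sum_t z t ^+ m.
Proof.
rewrite prod_cycle_type (big_distr_big t0) /=.
pose ext (f : {ffun {set 'I_N} -> T}) : {ffun 'I_N -> T} := [ffun x => f (porbit s x)].
(* Outside the cycles the value is [t0], as the families of [big_distr_big] require; this makes the
   function on cycles unique. *)
pose res h : {ffun {set 'I_N} -> T} :=
  [ffun X : {set 'I_N} => if (X \in porbits s) then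
     if [pick x in X] is Some x then h x else t0 else t0].
rewrite (reindex_onto ext res) => [|h hs]; last first.
  apply/ffunP => x; rewrite !ffunE imset_f //; case: pickP => [y|/(_ x)].
    exact: fixes_porbit.
  by rewrite porbit_id.
apply: eq_big => [f|f _].
  have -> : fixes (ext f) s = true.
    by apply/forallP => x; rewrite !ffunE; apply/eqP; congr (f _); exact: (porbit_perm s 1 x).
  apply/eqP/pfamilyP => [<-|[sf _]].
    split=> //; apply/fintype.subsetP => X; rewrite inE ffunE.
    by case: ifP => //; rewrite eqxx.
  apply/ffunP => X; rewrite ffunE; case: ifP => XP.
    case/imsetP: XP => x _ ->; case: pickP => [y|/(_ x)]; last by rewrite porbit_id.
    by rewrite ffunE -eq_porbit_mem => /eqP->.
  by apply/esym/eqP/negPn/negP => fX; have := fintype.subsetP sf X; rewrite inE XP => /(_ fX).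
rewrite (partition_big (porbit s) (mem (porbits s))) /=; last by move=> x _; exact: imset_f.
apply: eq_bigr => X XP; rewrite -(card_porbit_class XP) -prodr_const.
by apply: eq_bigr => x /eqP <-; rewrite ffunE.
Qed.

Lemma mem_cycle_type s : cycle_type s \in intparts N.
Proof.
rewrite mem_intparts; apply/and3P; split.
- by apply: sort_sorted => a b; exact: leq_total.
- rewrite mem_sort; apply/negP => /mapP[X].
  rewrite mem_enum => /imsetP[x _ ->] /esym/eqP.
  by rewrite cards_eq0 => /eqP e; have := porbit_id s x; rewrite e inE.
rewrite sumnE (perm_big _ (permEl (perm_sort _ _))) /= big_map big_enum /=.
apply/eqP; rewrite -[RHS]card_ord -sum1_card (partition_big (porbit s) (mem (porbits s))) /=; last first.
  by move=> x _; exact: imset_f.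
by apply: eq_bigr => X XP; rewrite -(card_porbit_class XP) -sum1_card.
Qed.

End FixedFunctions.

Definition digit_code (B n : nat) (c : 'I_n -> nat) : nat := (\sum_i c i * B ^ i)%N.

Lemma digit_code_inj B n (c d : 'I_n -> nat) : (forall i, (c i < B)%N) -> (forall i, (d i < B)%N) ->
  digit_code B c = digit_code B d -> c =1 d.
Proof.
elim: n c d => [|n IH] c d cB dB; first by move=> _ [].
have E (f : 'I_n.+1 -> nat) : digit_code B f = (f ord0 + B * digit_code B (fun i => f (lift ord0 i)))%N.
  rewrite /digit_code big_ord_recl /= expn0 muln1 big_distrr /=; congr addn.
  by apply: eq_bigr => i _; rewrite /bump /= add1n expnS mulnCA.
rewrite !E => e; have e0 : c ord0 = d ord0.
  by have := congr1 (modn^~ B) e; rewrite ![(_ + B * _)%N]addnC ![(B * _)%N]mulnC !modnMDl !modn_small.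
have B0 : (0 < B)%N by apply: leq_ltn_trans (cB ord0).
move: e; rewrite e0 => /addnI/eqP; rewrite eqn_pmul2l // => /eqP e i.
case: (unliftP ord0 i) => [j ->|->//].
exact: (IH _ _ (fun j => cB _) (fun j => dB _) e).
Qed.

Section CycleTypeValues.
Variables (N n : nat).

Definition kronecker_sum (m : nat) : {poly algC} := \sum_(i < n) 'X^(N.+1 ^ i) ^+ m.

(* The coefficient of y^c in the power sum of [lam].  The substitution
   y_i = 'X^((N+1)^i) keeps apart the monomials with exponents at most N. *)
Definition fixed_count (lam : seq nat) (c : {ffun 'I_n -> 'I_N.+1}) : algC :=
  (\prod_(m <- lam) kronecker_sum m)`_(digit_code N.+1 (fun i => c i)).

Lemma fixed_countE (t0 : 'I_n) (s : 'S_N) (c : {ffun 'I_n -> 'I_N.+1}) :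
  fixed_count (cycle_type s) c =
  #|[pred h : {ffun 'I_N -> 'I_n} | (content h == c) && fixes h s]|%:R.
Proof.
rewrite /fixed_count -(sum_fixes t0 s (fun i : 'I_n => 'X^(N.+1 ^ i) : {poly algC})).
rewrite coef_sum -sum1_card natr_sum big_mkcond [RHS]big_mkcond; apply: eq_bigr => h _.
rewrite inE; case: (fixes h s); rewrite ?andbT ?andbF //.
have -> : \prod_i 'X^(N.+1 ^ h i) = 'X^(digit_code N.+1 (fun t => content h t)) :> {poly algC}.
  rewrite -(big_morph _ (@exprD _ ('X : {poly algC})) (expr0 _)); congr ('X^_).
  rewrite (partition_big h xpredT) //=; apply: eq_bigr => t _.
  rewrite contentE -sum1_card big_distrl /=; apply: eq_big => [i|i /eqP->]; rewrite ?inE ?mul1n //.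
rewrite coefXn; case: (content h =P c) => [<-|hc]; first by rewrite eqxx.
case: eqP => // e; case: hc; apply/ffunP => t; apply: val_inj.
by apply/esym; apply: (digit_code_inj _ _ e) => i; exact: ltn_ord.
Qed.

Lemma cfInd_stab_cycle_type (t0 : 'I_n) (h : {ffun 'I_N -> 'I_n}) (s : 'S_N) :
  'Ind[[set: 'S_N]] (1 : 'CF(stab h)) s = fixed_count (cycle_type s) (content h).
Proof. by rewrite cfInd_stabE (fixed_countE t0). Qed.

End CycleTypeValues.

(** * Newton's identity for complete homogeneous sums *)

Section Newton.
Variables (F : numFieldType) (A : comAlgType F) (T : finType) (z : T -> A) (B : nat).

(** If all parts of [J] are below [B], this is 1 / z_J, with z_J the centralizer order of a
    permutation of cycle type [J]. *)
Definition inv_z (J : seq nat) : F :=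
  \prod_(1 <= j < B) ((j ^ count_mem j J * (count_mem j J)`!)%N%:R)^-1.

Definition psum (m : nat) : A := \sum_t z t ^+ m.

(** The complete homogeneous sum h_n; exponents in ['I_B] are no restriction when n < B. *)
Definition hsum (n : nat) : A :=
  \sum_(c : {ffun T -> 'I_B} | (\sum_t c t)%N == n) \prod_t z t ^+ c t.

Definition psum_parts (n : nat) : A :=
  \sum_(J <- intparts n) inv_z J *: \prod_(m <- J) psum m.

(** The product of [z t ^+ k] and h_(n-k) collects the monomials of degree n with exponent at least
    k at t. Over all t and k >= 1 a monomial is met as often as its exponents add up to, that is n
    times. *)
Lemma hsum_newton n : (n < B)%N -> n%:R * hsum n = \sum_(1 <= k < n.+1) psum k * hsum (n - k).
Proof.
move=> nB.
have shift k t : (0 < k <= n)%N -> z t ^+ k * hsum (n - k) =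
    \sum_(c : {ffun T -> 'I_B} | ((\sum_t c t)%N == n) && (k <= c t)%N) \prod_t z t ^+ c t.
  move=> /andP[k0 kn]; rewrite big_distrr /=.
  have leB (c : {ffun T -> 'I_B}) u : (c u <= \sum_t c t)%N by rewrite (bigD1 u) //= leq_addr.
  have B0 : (0 < B)%N by exact: leq_ltn_trans nB.
  pose o m : 'I_B := insubd (Ordinal B0) m.
  have oE m : (m < B)%N -> o m = m :> nat by move=> mB; rewrite val_insubd mB.
  pose up (c : {ffun T -> 'I_B}) : {ffun T -> 'I_B} := [ffun u => o (c u + (u == t) * k)%N].
  pose dn (c : {ffun T -> 'I_B}) : {ffun T -> 'I_B} := [ffun u => o (c u - (u == t) * k)%N].
  have dnE c u : dn c u = (c u - (u == t) * k)%N :> nat.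
    by rewrite ffunE oE // (leq_ltn_trans (leq_subr _ _)).
  have sumt : (\sum_u (u == t) * k = k)%N.
    by rewrite (bigD1 t) //= eqxx mul1n big1 ?addn0 // => u /negPf->.
  have upE (c : {ffun T -> 'I_B}) u : (\sum_t c t <= n - k)%N -> up c u = (c u + (u == t) * k)%N :> nat.
    move=> h; rewrite ffunE oE //; apply: leq_ltn_trans nB; rewrite -(subnK kn).
    apply: leq_add; first exact: leq_trans h.
    by case: (u == t); rewrite ?mul1n.
  rewrite [RHS](reindex_onto up dn) => [|c /andP[/eqP cn kc]]; last first.
    have sd : (\sum_u dn c u = n - k)%N.
      under eq_bigr do rewrite dnE; rewrite sumnB ?sumt ?cn // => u _.
      by case: eqP => [->|]; rewrite ?mul1n.
    apply/ffunP => u; apply: val_inj; rewrite /= upE ?sd // dnE subnK //.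
    by case: eqP => [->|]; rewrite ?mul1n.
  apply: eq_big => [c|c /eqP cn].
    apply/idP/idP => [/eqP cn|/andP[/andP[/eqP cn kc] /eqP dc]].
      have sc : (\sum_t c t <= n - k)%N by rewrite cn.
      have -> : dn (up c) = c by apply/ffunP => u; apply: val_inj; rewrite /= dnE upE // addnK.
      under eq_bigr do rewrite upE //.
      by rewrite big_split /= sumt cn subnK // !eqxx upE // eqxx mul1n leq_addl.
    rewrite -dc; under eq_bigr do rewrite dnE; rewrite sumnB ?sumt ?cn // => u _.
    by case: eqP => [->|]; rewrite ?mul1n.
  under [RHS]eq_bigr => u _ do rewrite upE ?cn // exprD.
  rewrite big_split /= mulrC; congr (_ * _).
  by rewrite (bigD1 t) //= eqxx mul1n big1 ?mulr1 // => u /negPf->.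
transitivity (\sum_(1 <= k < n.+1) \sum_t \sum_(c : {ffun T -> 'I_B} | ((\sum_t c t)%N == n)
  && (k <= c t)%N)
   \prod_t z t ^+ c t).
  under eq_bigr do under eq_bigr do rewrite big_mkcondr.
  rewrite exchange_big /=; under eq_bigr do rewrite exchange_big /=.
  rewrite exchange_big /= big_distrr /=; apply: eq_bigr => c /eqP cn.
  rewrite -[in LHS]cn natr_sum big_distrl /=; apply: eq_bigr => t _.
  have cB : (c t <= n)%N by rewrite -cn (bigD1 t) //= leq_addr.
  rewrite mulr_natl -big_mkcond /=.
  rewrite (eq_bigl (fun k => true && (k < (c t).+1)%N)) => [|k]; last by rewrite ltnS.
  by rewrite -big_nat_widen ?ltnS // sumr_const_nat subSS subn0.
rewrite big_nat [RHS]big_nat; apply: eq_bigr => k /andP[k0 kn].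
rewrite big_distrl /=; apply: eq_bigr => t _; rewrite shift //.
by rewrite k0 -ltnS.
Qed.

(** Write n as the sum of k a_k over the parts of J. Deleting one part k is a bijection from the
    partitions of n containing k to those of n - k, and it absorbs the factor: k a_k / z_J is 1 / z
    of the smaller partition. *)
Lemma psum_parts_newton n : (n < B)%N ->
  n%:R * psum_parts n = \sum_(1 <= k < n.+1) psum k * psum_parts (n - k).
Proof.
move=> nB.
have lamP J : J \in intparts n -> [/\ sorted geq J, 0%N \notin J & sumn J = n].
  by rewrite mem_intparts => /and3P[? ? /eqP].
transitivity (\sum_(1 <= k < n.+1) \sum_(J <- intparts n)
   (k * count_mem k J)%:R * (inv_z J *: \prod_(m <- J) psum m)).
  rewrite exchange_big /= big_distrr /= big_seq [RHS]big_seq; apply: eq_bigr => J /lamP[_ J0 Jn].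
  rewrite -big_distrl -natr_sum /=; congr (_%:R * _); rewrite -{1}Jn.
  have : all (fun m => 0 < m <= n)%N J.
    apply/allP => m mJ; rewrite lt0n; apply/andP; split; first by apply: contraNneq J0 => <-.
    by rewrite -Jn sumnE (perm_big _ (perm_to_rem mJ)) big_cons leq_addr.
  elim: (J) => [|m J' IH]; first by rewrite big1 // => k _; rewrite /= muln0.
  rewrite /= => /andP[mn /IH->].
  under [RHS]eq_bigr do rewrite mulnDr.
  rewrite big_split /=; congr addn.
  rewrite (bigD1_seq m) ?iota_uniq ?mem_index_iota ?ltnS //= eqxx muln1 big1 ?addn0 // => k /negPf.
  by rewrite eq_sym => ->; rewrite muln0.
rewrite big_nat [RHS]big_nat; apply: eq_bigr => k /andP[k0 kn].
have rem_perm : perm_eq [seq rem k J | J <- intparts n & k \in J] (intparts (n - k)).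
  have uniqP m : uniq (intparts m).
    have := intparts_sorted m; apply: sorted_uniq => [y x w /= xy wy|x]; last by rewrite /= ltxx.
    exact: lt_trans wy xy.
  have geq_anti : antisymmetric geq by move=> a b /=; rewrite andbC => /anti_leq.
  have geq_tr : transitive geq by move=> a b c /= ab bc; apply: leq_trans bc ab.
  apply: uniq_perm; rewrite ?uniqP //.
    rewrite map_inj_in_uniq ?filter_uniq ?uniqP // => I J; rewrite !mem_filter.
    move=> /andP[kI /lamP[sI _ _]] /andP[kJ /lamP[sJ _ _]] e.
    apply: (sorted_eq geq_tr geq_anti sI sJ).
    by rewrite (permPl (perm_to_rem kI)) perm_sym (permPl (perm_to_rem kJ)) e.
  move=> J; apply/mapP/idP => [[I]|].
    rewrite mem_filter => /andP[kI /lamP[sI I0 nI]] ->; rewrite mem_intparts; apply/and3P; split.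
    - exact: (subseq_sorted geq_tr (rem_subseq _ _) sI).
    - by apply: contra I0; exact: mem_rem.
    by rewrite -nI !sumnE (perm_big _ (perm_to_rem kI)) big_cons addKn.
  rewrite mem_intparts => /and3P[sJ J0 /eqP nJ].
  have pJ : perm_eq (sort geq (k :: J)) (k :: J) by rewrite perm_sort.
  exists (sort geq (k :: J)).
    rewrite mem_filter mem_sort mem_head mem_intparts /=; apply/and3P; split.
    - by apply: sort_sorted => a b; exact: leq_total.
    - by rewrite mem_sort inE negb_or J0 eq_sym -lt0n k0.
    by rewrite (perm_sumn pJ) /= nJ subnKC // -ltnS.
  apply: (sorted_eq geq_tr geq_anti sJ).
    apply: (subseq_sorted geq_tr (rem_subseq _ _)).
    by apply: sort_sorted => a b; exact: leq_total.
  rewrite -(perm_cons k) perm_sym -(permPl (perm_to_rem _)) ?mem_sort ?mem_head //.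
rewrite /psum_parts -(perm_big _ rem_perm) /= big_map big_filter big_distrr /= [RHS]big_mkcond.
rewrite big_seq [RHS]big_seq; apply: eq_bigr => J /lamP[sJ J0 nJ].
case: ifP => kJ; last by rewrite (count_memPn _) ?kJ // muln0 mul0r.
rewrite (perm_big _ (perm_to_rem kJ)) big_cons -scalerAr mulr_natl -scaler_nat !scalerA -scalerAr.
congr (_ *: _).
have kB : (k < B)%N by apply: leq_ltn_trans nB.
have cE j : count_mem j J = ((k == j) + count_mem j (rem k J))%N.
  by rewrite (seq.permP (perm_to_rem kJ)).
rewrite /inv_z (bigD1_seq k) ?iota_uniq ?mem_index_iota ?k0 //=.
rewrite [RHS](bigD1_seq k) ?iota_uniq ?mem_index_iota ?k0 //= mulrAC; congr (_ * _); last first.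
  by apply: eq_bigr => j /negPf jk; rewrite cE eq_sym jk.
rewrite cE eqxx add1n expnS factS.
set a := count_mem k _; rewrite [X in X^-1](_ : _ = (k * a.+1)%N%:R * (k ^ a * a`!)%N%:R); last first.
  by rewrite -natrM; congr (_%:R); lia.
by rewrite invfM mulrAC mulVf ?mul1r // pnatr_eq0 muln_eq0 negb_or -lt0n k0.
Qed.

Lemma psum_parts_hsum n : (n < B)%N -> psum_parts n = hsum n.
Proof.
elim/ltn_ind: n => n IH nB; case: n => [|n] in IH nB *.
  rewrite /psum_parts /hsum /intparts /= big_seq1 big_nil.
  rewrite /inv_z big1 => [|j _]; last by rewrite expn0 invr1.
  rewrite scale1r (big_pred1 [ffun=> Ordinal nB]) => [|c].
    by rewrite big1 // => t _; rewrite ffunE expr0.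
  rewrite sum_nat_eq0; apply/forallP/eqP => [c0|-> t]; last by rewrite ffunE.
  by apply/ffunP => t; apply: val_inj; rewrite ffunE /=; exact/eqP/c0.
have n0 : n.+1%:R != 0 :> F by rewrite pnatr_eq0.
have nE (x : A) : n.+1%:R *: x = n.+1%:R * x by rewrite scaler_nat mulr_natl.
apply: (scalerI n0); rewrite !nE (psum_parts_newton nB) (hsum_newton nB).
rewrite big_nat [RHS]big_nat; apply: eq_bigr => k /andP[k0 kn]; rewrite IH //; lia.
Qed.

End Newton.

Section ClassSizes.
Variable N : nat.
Hypothesis N_gt0 : (0 < N)%N.
Implicit Types I J K : 'I_(nparts N).

Let t0 : 'I_N := Ordinal N_gt0.

Definition class_card J : nat := #|[pred s : 'S_N | cycle_type s == part J]|.

Lemma sum_intparts (V : nmodType) (f : seq nat -> V) :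
  \sum_(lam <- intparts N) f lam = \sum_(J < nparts N) f (part J).
Proof. by rewrite (big_nth [::]) big_mkord. Qed.

Lemma sum_classes (V : nmodType) (f : 'S_N -> V) :
  \sum_s f s = \sum_(J < nparts N) \sum_(s | cycle_type s == part J) f s.
Proof.
under [RHS]eq_bigr do rewrite big_mkcond.
rewrite exchange_big; apply: eq_bigr => s _; have [J eJ] := partP (mem_cycle_type s).
rewrite -big_mkcond (big_pred1 J) ?eJ // => I /=.
by rewrite -eJ (inj_eq (@part_inj N)) eq_sym.
Qed.

Lemma sum_cycle_type (V : nmodType) (f : seq nat -> V) :
  \sum_(s : 'S_N) f (cycle_type s) = \sum_(J < nparts N) f (part J) *+ class_card J.
Proof.
rewrite sum_classes; apply: eq_bigr => J _; rewrite -sumr_const.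
by apply: eq_bigr => s /eqP->.
Qed.

(** Columns are indexed by all partitions; [fixed_count] makes sense without a permutation of that
    cycle type, so nonemptiness of the classes is not presupposed. *)
Definition young_table : 'M[algC]_(nparts N) :=
  \matrix_(I, J) fixed_count (part J) (content (part_row I)).

Lemma young_table_gram :
  young_table *m diag_mx (\row_J ((class_card J)%:R / N`!%:R)) *m young_table^T =
  (map_mx intr (kostka N))^T *m map_mx intr (kostka N).
Proof.
apply/matrixP => I I'; rewrite mul_mx_diag !mxE.
transitivity ('[young_cf I, young_cf I']).
  rewrite cfdotE cardsT card_Sn.
  rewrite (eq_bigr (fun s : 'S_N => (fun lam => fixed_count lam (content (part_row I)) *
      fixed_count lam (content (part_row I'))) (cycle_type s))) => [|s _]; last first.
    rewrite -(cfInd_stab_cycle_type t0) -(cfInd_stab_cycle_type t0).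
    by congr (_ * _); rewrite cfInd_stabE conjC_nat.
  rewrite (eq_bigl xpredT) => [|s]; last by rewrite inE.
  rewrite (sum_cycle_type (fun lam => fixed_count lam (content (part_row I)) *
      fixed_count lam (content (part_row I')))) big_distrr /=; apply: eq_bigr => J _;
        rewrite !mxE -[X in _ = _ * X]mulr_natr.
  by ring.
rewrite cfdot_young_Ind; apply: eq_bigr => K _.
have E L : map_mx intr (kostka N) K L = (kostka N K L)%:~R :> algC by exact: mxE.
by rewrite [_^T _ _]mxE !E [kostka N K I']kostka_chains -pmulrn.
Qed.

Lemma young_table_unit : young_table \in unitmx.
Proof.
have : (map_mx intr (kostka N))^T *m map_mx intr (kostka N) \in @unitmx algC _.
  by rewrite unitmx_mul unitmx_tr unitmxE det_map_mx det_kostka rmorph1 unitr1.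
by rewrite -young_table_gram !unitmx_mul => /andP[/andP[]].
Qed.

Lemma sum_young_table_card I : \sum_J young_table I J * ((class_card J)%:R / N`!%:R) = 1.
Proof.
transitivity ('[young_cf I, 1]); last by rewrite -cfdot_Res_r cfRes_cfun1 cfnorm1.
rewrite cfdotE cardsT card_Sn [in RHS](eq_bigl xpredT) => [|s]; last by rewrite inE.
rewrite [in RHS](eq_bigr (fun s : 'S_N => fixed_count (cycle_type s) (content (part_row I)))) =>
  [|s _]; last first.
  by rewrite (cfInd_stab_cycle_type t0) cfun1E inE conjC1 mulr1.
rewrite (sum_cycle_type (fun lam => fixed_count lam (content (part_row I)))) big_distrr /=;
  apply: eq_bigr => J _; rewrite !mxE -[X in _ = _ * X]mulr_natr.
by ring.
Qed.

(** In h_N, which equals the sum of p_J / z_J, the monomial whose exponents are the content of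
    [part_row I] has coefficient 1. *)
Lemma sum_young_table_inv_z I : \sum_J young_table I J * inv_z algC N.+1 (part J) = 1.
Proof.
have := psum_parts_hsum (fun i : 'I_N => 'X^(N.+1 ^ i) : {poly algC}) (ltnSn N).
move/(congr1 (fun p : {poly algC} => p`_(digit_code N.+1 (fun i => content (part_row I) i)))).
rewrite /psum_parts sum_intparts !coef_sum => e.
transitivity (\sum_(J < nparts N) (inv_z algC N.+1 (part J) *: \prod_(m <- part J) psum
   (fun i : 'I_N => 'X^(N.+1 ^ i) : {poly algC}) m)`_(digit_code N.+1 (fun i =>
     content (part_row I) i))).
  by apply: eq_bigr => J _; rewrite mxE coefZ mulrC.
rewrite e (bigD1 (content (part_row I))) /= ?sum_content //.
have codeE (c : {ffun 'I_N -> 'I_N.+1}) :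
    \prod_(t < N) ('X^(N.+1 ^ t) : {poly algC}) ^+ c t = 'X^(digit_code N.+1 (fun i => c i)).
  under eq_bigr do rewrite -exprM mulnC.
  by rewrite -(big_morph _ (@exprD _ ('X : {poly algC})) (expr0 _)).
rewrite codeE coefXn eqxx big1 ?addr0 // => c /andP[_ /eqP nc].
rewrite codeE coefXn; case: eqP => // ec; case: nc; apply/ffunP => t; apply: val_inj.
by apply/esym; apply: (digit_code_inj _ _ ec) => i; exact: ltn_ord.
Qed.

(* The sums above express that two families of class weights agree on all
   permutation characters, and those separate the cycle types. *)
Lemma class_card_inv_z J : (class_card J)%:R = N`!%:R * inv_z algC N.+1 (part J).
Proof.
pose u := \col_J (inv_z algC N.+1 (part J) - (class_card J)%:R / N`!%:R).
have yu : young_table *m u = 0.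
  apply/matrixP => I k; rewrite !mxE.
  under eq_bigr do rewrite [u _ _]mxE mulrBr.
  by rewrite sumrB sum_young_table_inv_z sum_young_table_card subrr.
have u0 : u = 0 by rewrite -(mulKmx young_table_unit u) yu mulmx0.
have /matrixP/(_ J ord0) := u0; rewrite !mxE => /eqP; rewrite subr_eq0 => /eqP->.
by rewrite mulrC divfK // pnatr_eq0 -lt0n fact_gt0.
Qed.

Lemma class_card_mul J :
  (class_card J * \prod_(1 <= j < N.+1) (j ^ mult J j * (mult J j)`!) = N`!)%N.
Proof.
apply/eqP; rewrite -(eqr_nat algC) natrM class_card_inv_z /inv_z natr_prod.
rewrite -mulrA -big_split /= big_nat big1 ?mulr1 // => j /andP[j0 _].
by rewrite mulVf // pnatr_eq0 -lt0n muln_gt0 expn_gt0 j0 fact_gt0.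
Qed.

End ClassSizes.

(** * Finitely many levels *)

Lemma nth_filter_pos (s : seq nat) i : sorted geq s ->
  nth 0%N [seq m <- s | (0 < m)%N] i = nth 0%N s i.
Proof.
have geq_tr : transitive geq by move=> a b c /= ab bc; apply: leq_trans bc ab.
elim: s i => [|a s IH] i //= sas; have ss := path_sorted sas.
case: (posnP a) => [a0|a0]; last by case: i => //= i; exact: IH.
have s0 j : nth 0%N s j = 0%N.
  case: (ltnP j (size s)) => js; last by rewrite nth_default.
  have /(all_nthP 0%N)/(_ j js) := order_path_min geq_tr sas.
  by rewrite /= a0 leqn0 => /eqP.
by rewrite IH // s0 a0; case: i => [|i] //=; rewrite s0.
Qed.

(* Relabelling the letters turns [h] into the row function of the partition
   formed by the nonzero multiplicities of [h]. *)
Lemma young_of_content N n (h : {ffun 'I_N -> 'I_n}) : (N <= n)%N ->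
  exists2 L : 'I_(nparts N), 'Ind[[set: 'S_N]] (1 : 'CF(stab h)) = young_cf L &
    exists p : 'S_n, forall t, content h t = nth 0%N (part L) (p t) :> nat.
Proof.
move=> Nn; pose s := sort geq (content_word h); pose lam := [seq m <- s | (0 < m)%N].
have geq_tr : transitive geq by move=> a b c /= ab bc; apply: leq_trans bc ab.
have ss : sorted geq s by apply: sort_sorted => a b; exact: leq_total.
have lamN : lam \in intparts N.
  rewrite mem_intparts; apply/and3P; split; first exact: sorted_filter.
    by rewrite mem_filter ltnn.
  rewrite -[X in _ == X](sumn_content_word h) sumnE big_filter big_mkcond.
  rewrite (perm_big _ (permEl (perm_sort _ _))) sumnE /=.
  by apply/eqP/eq_bigr => -[].
have [L eL] := partP lamN.
have [p hp] : exists p : 'S_n, forall t, content h t = nth 0%N lam (p t) :> nat.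
  have : perm_eq [tuple (content h t : nat) | t < n] [tuple nth 0%N lam t | t < n].
    rewrite -(permPl (permEl (perm_sort geq _))) /= -/(content_word h) -/s.
    suff -> : [seq nth 0%N lam (t : 'I_n) | t <- enum 'I_n] = s by [].
    have sz : size s = n by rewrite size_sort size_content_word.
    apply: (@eq_from_nth _ 0%N) => [|i]; rewrite size_map size_enum_ord ?sz // => iN.
    by rewrite (nth_map (Ordinal iN)) ?size_enum_ord // (nth_ord_enum _ (Ordinal iN)) nth_filter_pos.
  move/tuple_permP => [p /val_inj ep]; exists p => t.
  by have := congr1 (fun u => tnth u t) ep; rewrite !tnth_mktuple.
have rowN (x : 'I_N) : (row_of lam x < n)%N by exact: leq_trans (row_ltN lamN x) Nn.
pose g : {ffun 'I_N -> 'I_n} := [ffun x => Ordinal (rowN x)].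
pose h' : {ffun 'I_N -> 'I_n} := [ffun x => p (h x)].
have cg : content h' = content g.
  apply/ffunP => t; apply: val_inj; rewrite /= !contentE.
  transitivity (nth 0%N lam t).
    rewrite -[in RHS](permKV p t) -hp contentE; apply: eq_card => x.
    by rewrite !inE ffunE -{1}(permKV p t) (inj_eq perm_inj).
  by rewrite -(card_row lamN); apply: eq_card => x; rewrite !inE ffunE -val_eqE.
exists L; last by exists p => t; rewrite eL.
have -> : 'Ind[[set: 'S_N]] (1 : 'CF(stab h)) = 'Ind (1 : 'CF(stab h')).
  apply: Ind_cfun1_eq; apply/setP => y; rewrite /= !mem_stab; apply: eq_forallb => x.
  by rewrite !ffunE (inj_eq perm_inj).
have -> : 'Ind[[set: 'S_N]] (1 : 'CF(stab h')) = 'Ind (1 : 'CF(stab g)).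
  by apply/cfunP => y; rewrite !cfInd_stabE cg.
apply: Ind_cfun1_eq; rewrite /= stab_row_fun eL; apply/setP => y; rewrite mem_stab inE.
by apply: eq_forallb => x; rewrite !ffunE -val_eqE.
Qed.

Section FiniteIdentity.
Variable N : nat.
Hypothesis N_gt0 : (0 < N)%N.
Implicit Types I J K L : 'I_(nparts N).

Lemma schur_cf_cycle_type I (s : 'S_N) :
  schur_cf I s = \sum_L (inv_kostka N L I)%:~R * fixed_count (cycle_type s) (content (part_row L)).
Proof.
rewrite sum_cfunE; apply: eq_bigr => L _.
by rewrite cfunE (cfInd_stab_cycle_type (Ordinal N_gt0)).
Qed.

Lemma chi_valE I J (s : 'S_N) : cycle_type s = part J -> (chi_val I J)%:~R = schur_cf I s.
Proof.
move=> sJ; rewrite /chi_val sym_charE floorK ?schur_int // !schur_cf_cycle_type.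
set A := [set s | _]; suff : repr A \in A by rewrite inE sJ => /eqP->.
by apply: (mem_repr s); rewrite inE sJ.
Qed.

(** Both sides are the sum of chi^I over [stab h]: on the left grouped by cycle type, on the right
    evaluated by Frobenius reciprocity. *)
Lemma sum_chi_stab n (h : {ffun 'I_N -> 'I_n}) I :
  \sum_J chi_val I J * #|[pred s : 'S_N | (cycle_type s == part J) && fixes h s]|%:Z =
  #|stab h|%:Z * (chains (content_word h) (part_shape N (part I)))%:Z.
Proof.
apply/eqP; rewrite -(eqr_int algC) rmorphM rmorph_sum /= -!pmulrn; apply/eqP.
rewrite -cfdot_schur_Ind -cfdot_Res_l cfdotE mulrA mulfV ?mul1r; last first.
  by rewrite pnatr_eq0 -lt0n cardG_gt0.
transitivity (\sum_(J < nparts N) \sum_(s : 'S_N | cycle_type s == part J)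
  (fixes h s)%:R * schur_cf I s).
  apply: eq_bigr => J _; rewrite rmorphM /= -pmulrn -sum1_card natr_sum big_distrr /=.
  rewrite big_mkcond [RHS]big_mkcond; apply: eq_bigr => s _; rewrite inE.
  case: eqP => // sJ; rewrite (chi_valE I sJ).
  by case: (fixes h s); rewrite ?mulr1 ?mul1r ?mul0r.
rewrite -(sum_classes (fun s => (fixes h s)%:R * schur_cf I s)) [RHS]big_mkcond; apply: eq_bigr => s _.
have -> : (s \in stab_group h) = fixes h s by exact: mem_stab.
case hs : (fixes h s); last by rewrite mul0r.
have sh : s \in stab_group h by rewrite -[_ \in _]/(s \in stab h) mem_stab.
by rewrite cfResE ?finset.subsetT // cfun1E sh conjC1 mulr1 mul1r.
Qed.

Lemma prod_count (R : comPzSemiRingType) (F : nat -> R) (s : seq nat) B :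
  all (fun m => 0 < m < B)%N s ->
  \prod_(m <- s) F m = \prod_(1 <= m < B) F m ^+ count_mem m s.
Proof.
elim: s => [|m s IH] /=; first by rewrite big_nil big1.
move=> /andP[mB /IH e]; rewrite big_cons e; under [RHS]eq_bigr do rewrite exprD.
rewrite big_split /=; congr (_ * _).
rewrite (bigD1_seq m) ?iota_uniq ?mem_index_iota //= eqxx big1 ?mulr1 // => k /negPf.
by rewrite eq_sym => ->.
Qed.

Lemma part_bounds J : all (fun m => 0 < m < N.+1)%N (part J).
Proof.
have := mem_part J; rewrite mem_intparts => /and3P[_ J0 /eqP JN].
apply/allP => m mJ; rewrite lt0n ltnS; apply/andP; split; first by apply: contraNneq J0 => <-.
by rewrite -JN sumnE (perm_big _ (perm_to_rem mJ)) big_cons leq_addr.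
Qed.

(** As g_J is a class size, the left side averages chi^I(s) times the power sums of the cycles of s,
    and the latter sum the words fixed by s. Exchanging the sums gives, word by word, the expansion
    of a Schur function in monomials with Kostka coefficients. *)
Lemma sum_gcoef_fixes (R : realType) n (i0 : 'I_n) (x : 'I_n -> R) I :
  \sum_J g_coef R J / N`!%:R * (chi_val I J)%:~R * \prod_(1 <= m < N.+1) (\sum_i x i ^+ m) ^+ mult J m =
  N`!%:R^-1 * \sum_(h : {ffun 'I_N -> 'I_n})
     \prod_i x (h i) * (#|stab h| * chains (content_word h) (part_shape N (part I)))%N%:R.
Proof.
rewrite big_distrr /=.
transitivity (\sum_(J < nparts N) N`!%:R^-1 * ((chi_val I J)%:~R *
  \sum_(s : 'S_N | cycle_type s == part J) \sum_(h : {ffun 'I_N -> 'I_n} | fixes h s) \prod_i x (h i))).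
  apply: eq_bigr => J _.
  have -> : g_coef R J = (class_card J)%:R.
    have z0 : (0 < \prod_(1 <= j < N.+1) (j ^ mult J j * (mult J j)`!))%N.
      by have := fact_gt0 N; rewrite -(class_card_mul N_gt0 J) muln_gt0 => /andP[].
    by rewrite /g_coef -(class_card_mul N_gt0 J) natrM mulfK // pnatr_eq0 -lt0n.
  have -> : \sum_(s : 'S_N | cycle_type s == part J) \sum_(h : {ffun 'I_N -> 'I_n} | fixes h s)
    \prod_i x (h i) =
      (class_card J)%:R * \prod_(1 <= m < N.+1) (\sum_i x i ^+ m) ^+ mult J m.
    rewrite -(prod_count (fun m => \sum_i x i ^+ m) (part_bounds J)) mulr_natl -sumr_const.
    by apply: eq_bigr => s /eqP sJ; rewrite (sum_fixes i0) sJ.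
  by ring.
rewrite -!big_distrr /=; congr (_ * _).
transitivity (\sum_(J < nparts N) \sum_(h : {ffun 'I_N -> 'I_n}) \prod_i x (h i) *
   (chi_val I J * #|[pred s : 'S_N | (cycle_type s == part J) && fixes h s]|%:Z)%:~R).
  apply: eq_bigr => J _; under eq_bigr do rewrite big_mkcond.
  rewrite exchange_big big_distrr /=; apply: eq_bigr => h _.
  rewrite rmorphM /= mulrCA; congr (_ * _).
  rewrite -big_mkcondr -pmulrn mulr_natr -sumr_const.
  by apply: eq_bigl => s.
rewrite exchange_big; apply: eq_bigr => h _ /=.
rewrite -big_distrr /=; congr (_ * _).
by rewrite -rmorph_sum /= sum_chi_stab -PoszM -pmulrn.
Qed.

Lemma sum_Qcoef_chains n q (h : {ffun 'I_N -> 'I_n}) : (N <= n)%N ->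
  \sum_(I < nparts N) Qcoef q I * (chains (content_word h) (part_shape N (part I)))%:Z =
  ([forall t, (content h t <= q)%N] : nat)%:Z.
Proof.
move=> Nn; have [L eL [p hp]] := young_of_content h Nn.
(* A Kostka number does not depend on the order of the weight: both sides are pairings of
   [schur_cf I] with the same induced character. *)
have cE I : (chains (content_word h) (part_shape N (part I)))%:Z = kostka N I L.
  by apply/eqP; rewrite -(eqr_int algC) -cfdot_schur_young -eL cfdot_schur_Ind -pmulrn.
under eq_bigr => I _ do rewrite cE big_distrl /=.
rewrite exchange_big /=.
under eq_bigr => K _ do under eq_bigr => I _ do rewrite mulrAC.
under eq_bigr => K _ do rewrite -big_distrl /=.
rewrite (eq_bigr (fun K => (K == L)%:R * Gam q K)) => [|K _]; last first.
  by rewrite -mulrV_kostka; congr (_ * _); apply: eq_bigr => I _; rewrite !intz.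
rewrite (bigD1 L) //= eqxx mul1r big1 ?addr0 => [|K /negPf->]; last by rewrite mul0r.
rewrite /Gam; have n0 : (0 < n)%N by exact: leq_trans N_gt0 Nn.
case: ltnP => hq.
  (* The letter that [p] sends to 0 has as its multiplicity the largest part of [part L]. *)
  rewrite (_ : [forall t, _] = false) //; apply/negP => /forallP/(_ ((p^-1)%g (Ordinal n0))).
  by rewrite hp permKV leqNgt hq.
rewrite (_ : [forall t, _] = true) //; apply/forallP => t; rewrite hp; apply: leq_trans hq.
exact: intpart_nonincr (mem_part L) _ _ _.
Qed.

(** After exchanging sums a word counts |stab h| times the indicator that no letter occurs more than
    q times; [burnside] passes from words to occupation numbers and cancels the N!. *)
Lemma gentile_finite (R : realType) n q (x : 'I_n -> R) : (N <= n)%N ->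
  \sum_(I < nparts N) (Qcoef q I)%:~R * (\sum_(J < nparts N) g_coef R J / N`!%:R * (chi_val I J)%:~R *
     \prod_(1 <= m < N.+1) (\sum_i x i ^+ m) ^+ mult J m) =
  \sum_(c : {ffun 'I_n -> 'I_N.+1} | ((\sum_t c t)%N == N) && [forall t, (c t <= q)%N])
    \prod_t x t ^+ c t.
Proof.
move=> Nn; have n0 : (0 < n)%N by exact: leq_trans N_gt0 Nn.
under eq_bigr => I _ do rewrite (sum_gcoef_fixes (Ordinal n0)) mulrCA big_distrr /=.
rewrite -big_distrr exchange_big /=.
have N0 : N`!%:R != 0 :> R by rewrite pnatr_eq0 -lt0n fact_gt0.
apply: (mulfI N0); rewrite mulVKf //.
transitivity (\sum_(h : {ffun 'I_N -> 'I_n})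
   ([forall t, (content h t <= q)%N]%:R * \prod_t x t ^+ content h t) *+ #|stab h|).
  apply: eq_bigr => h _.
  have -> : \prod_i x (h i) = \prod_t x t ^+ content h t.
    rewrite (partition_big h xpredT) //=; apply: eq_bigr => t _.
    by rewrite contentE -prodr_const; apply: eq_big => [i|i /eqP->//]; rewrite inE.
  have := congr1 (fun m : int => m%:~R : R) (sum_Qcoef_chains q h Nn).
  rewrite rmorph_sum -[RHS]pmulrn /=; under eq_bigr do rewrite rmorphM /= -pmulrn.
  move=> <-; rewrite mulr_suml -sumrMnl; apply: eq_bigr => I _.
  by rewrite natrM -[RHS]mulr_natr; ring.
rewrite (burnside (fun c : {ffun 'I_n -> 'I_N.+1} => [forall t, (c t <= q)%N]%:R * \prod_t x t ^+ c t)).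
rewrite sumrMnl -[LHS]mulr_natl; congr (_ * _); rewrite big_mkcondr.
by apply: eq_bigr => c _; case: ifP; rewrite ?mul1r ?mul0r.
Qed.

End FiniteIdentity.

(** * Infinitely many levels *)

Section Occupations.
Variables (R : realType) (N q : nat).
Implicit Types (n : nat) (o : occupation).

Lemma big_finsupp (V : Type) (idx : V) (op : Monoid.com_law idx) n o (F : nat -> nat -> V) :
  (forall i, (n <= i)%N -> o i = 0%N) -> (forall i, F i 0%N = idx) ->
  \big[op/idx]_(i <- finsupp o) F i (o i) = \big[op/idx]_(i < n) F i (o i).
Proof.
move=> on F0; rewrite -(big_mkord xpredT (fun i => F i (o i))) [RHS](bigID (mem (finsupp o))) /=.
rewrite [X in op _ X]big1 ?Monoid.mulm1 => [|i]; last by rewrite memNfinsupp => /eqP->; rewrite F0.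
rewrite -[RHS]big_filter; apply: perm_big; apply: uniq_perm.
- exact: fset_uniq.
- by rewrite filter_uniq ?iota_uniq.
move=> i; rewrite mem_filter mem_index_iota /=; case: (boolP (i \in finsupp o)) => //.
by rewrite mem_finsupp; case: ltnP => // /on ->; rewrite eqxx.
Qed.

Definition occ_of n (c : {ffun 'I_n -> 'I_N.+1}) : occupation :=
  [fsfun i in seq_fset tt (iota 0 n) => if insub i is Some t then c t : nat else 0%N].

Lemma occ_ofE n (c : {ffun 'I_n -> 'I_N.+1}) (t : 'I_n) : occ_of c t = c t.
Proof. by rewrite fsfunE seq_fsetE mem_iota ltn_ord valK. Qed.

Lemma occ_of_out n (c : {ffun 'I_n -> 'I_N.+1}) i : (n <= i)%N -> occ_of c i = 0%N.
Proof. by move=> ni; rewrite fsfunE seq_fsetE mem_iota add0n ltnNge ni. Qed.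

Lemma occ_of_inj n : injective (@occ_of n).
Proof. by move=> c d e; apply/ffunP => t; apply: val_inj; rewrite /= -!occ_ofE e. Qed.

Definition bounded_contents n : {set {ffun 'I_n -> 'I_N.+1}} :=
  [set c : {ffun 'I_n -> 'I_N.+1} | ((\sum_t c t)%N == N) && [forall t, (c t <= q)%N]].

Definition bounded_occs n : seq occupation := [seq occ_of c | c <- enum (bounded_contents n)].

Lemma uniq_bounded_occs n : uniq (bounded_occs n).
Proof. by rewrite map_inj_uniq ?enum_uniq //; exact: occ_of_inj. Qed.

Lemma mem_bounded_occs n o :
  o \in bounded_occs n <-> gentile_states N q o /\ forall i, (n <= i)%N -> o i = 0%N.
Proof.
split=> [/mapP[c]|[[oq oN] on]].
  rewrite mem_enum inE => /andP[/eqP cN /forallP cq] ->; split; last exact: occ_of_out.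
  split=> [i|]; last first.
    rewrite (@big_finsupp _ _ _ n _ (fun _ m => m)) //; last exact: occ_of_out.
    by rewrite -[RHS]cN; apply: eq_bigr => t _; rewrite occ_ofE.
  case: (ltnP i n) => ni; last by rewrite occ_of_out.
  by rewrite (occ_ofE c (Ordinal ni)).
have sN : (\sum_(i < n) o i)%N = N by rewrite -oN (@big_finsupp _ _ _ n _ (fun _ m => m)).
have oN1 (t : 'I_n) : (o t < N.+1)%N by rewrite ltnS -sN (bigD1 t) //= leq_addr.
pose c : {ffun 'I_n -> 'I_N.+1} := [ffun t : 'I_n => Ordinal (oN1 t)].
apply/mapP; exists c.
  rewrite mem_enum inE; apply/andP; split; last by apply/forallP => t; rewrite ffunE; exact: oq.
  by rewrite -[X in _ == X]sN; apply/eqP/eq_bigr => t _; rewrite ffunE.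
apply/fsfunP => i; case: (ltnP i n) => ni; last by rewrite on // occ_of_out.
by rewrite (occ_ofE c (Ordinal ni)) ffunE.
Qed.

Variables (beta : R) (eps : nat -> R).
Let x i := expR (- beta * eps i).
Let W o := expR (- beta * gentile_energy eps o).

Lemma boltzmann_prod n o : (forall i, (n <= i)%N -> o i = 0%N) -> W o = \prod_(i < n) x i ^+ o i.
Proof.
move=> on; rewrite /W /gentile_energy big_distrr /= expR_sum.
rewrite -(@big_finsupp _ _ _ n _ (fun i m => x i ^+ m)) //.
by apply: eq_bigr => i _; rewrite -expRM_natl mulrCA.
Qed.

Lemma sum_bounded_occs n :
  \sum_(o <- bounded_occs n) W o = \sum_(c in bounded_contents n) \prod_(t < n) x t ^+ c t.
Proof.
rewrite big_map big_enum /=; apply: eq_bigr => c _.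
rewrite (boltzmann_prod (occ_of_out c)); by apply: eq_bigr => t _; rewrite occ_ofE.
Qed.

Lemma finite_support o : exists n0, forall n, (n0 <= n)%N -> forall i, (n <= i)%N -> o i = 0%N.
Proof.
exists (\max_(i <- finsupp o) i.+1)%N => n hn i ni; apply/eqP; rewrite -memNfinsupp.
apply/negP => io; have : (i.+1 <= n)%N.
  by apply: leq_trans hn; exact: (@leq_bigmax_seq _ (enum_fset (finsupp o)) xpredT succn i io isT).
by rewrite ltnNge ni.
Qed.

Lemma ler_sum_subset (T : eqType) (s r : seq T) (F : T -> R) : uniq s -> uniq r ->
  {subset s <= r} -> (forall y, 0 <= F y) -> \sum_(y <- s) F y <= \sum_(y <- r) F y.
Proof.
move=> us ur sr F0; rewrite [leRHS](bigID (mem s)) /= -[X in _ <= X + _]big_filter.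
rewrite (perm_big [seq y <- r | y \in s]) ?lerDl ?sumr_ge0 //.
apply: uniq_perm; rewrite ?filter_uniq // => y; rewrite mem_filter.
by case: (boolP (y \in s)) => //= /sr ->.
Qed.

(** The states on the first n levels form a finite subset of all states, which gives one inequality.
    Conversely every finite set of states lives on the first n levels for all large n, and the
    Boltzmann weights are nonnegative. *)
Lemma canonical_Z_lim (l : R) :
  ((fun n => \sum_(c in bounded_contents n) \prod_(t < n) x t ^+ c t) @ \oo --> l)%classic ->
  gentile_Z eps q beta N = l%:E.
Proof.
move=> cl; rewrite /gentile_Z /canonical_Z; set S := (X in X = _).
have Zle n : ((\sum_(c in bounded_contents n) \prod_(t < n) x t ^+ c t)%:E <= S)%E.
  apply: esum_ge; exists [set` bounded_occs n]%classic.
    by split; [exact: finite_seq|move=> o /= /mem_bounded_occs[]].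
  rewrite -sum_bounded_occs -sumEFin; rewrite -(fsbig_seq _ (fun o => (W o)%:E)) //.
  exact: uniq_bounded_occs.
apply/eqP; rewrite eq_le; apply/andP; split.
  apply: ge_ereal_sup => _ [X [finX XS] <-].
  have [n0 hn0] : exists n0, forall n, (n0 <= n)%N -> {subset enum_fset (fset_set X) <= bounded_occs n}.
    have [n0 hn0] : exists n0, forall n, (n0 <= n)%N ->
        forall o, o \in enum_fset (fset_set X) -> forall i, (n <= i)%N -> o i = 0%N.
      elim: (enum_fset _) => [|o s [n1 h1]]; first by exists 0%N.
      have [n2 h2] := finite_support o; exists (maxn n1 n2) => n; rewrite geq_max => /andP[n1n n2n] o'.
      by rewrite inE => /predU1P[->|]; [exact: h2|exact: h1].
    exists n0 => n n0n o oX; apply/mem_bounded_occs; split; last exact: (hn0 _ n0n _ oX).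
    by apply: XS; have : o \in fset_set X by []; rewrite in_fset_set // inE.
  rewrite fsbig_finite //= sumEFin lee_fin -(cvg_lim (@Rhausdorff R) cl).
  apply: limr_ge; first by apply/cvg_ex; exists l.
  near=> n; rewrite -sum_bounded_occs; apply: ler_sum_subset.
  - exact: fset_uniq.
  - exact: uniq_bounded_occs.
  - by apply: hn0; near: n; exact: nbhs_infty_ge.
  by move=> o; exact: expR_ge0.
case: S Zle => [r| |] Zle; [|by rewrite leey|by have := Zle 0%N].
rewrite lee_fin -(cvg_lim (@Rhausdorff R) cl); apply: limr_le; first by apply/cvg_ex; exists l.
by near=> n; rewrite -lee_fin.
Unshelve. all: by end_near.
Qed.

End Occupations.

(** * Convergence of power sums and S-functions *)

Section PowerSums.
Variables (R : realType) (x : nat -> R).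
Hypotheses (x_ge0 : forall i, 0 <= x i) (x_summable : cvgn (series x)).

(** The total M of the series bounds every [x i], so the (m+1)-st powers are dominated by M^m times
    the summable [x i]. *)
Lemma cvg_power_sum m : (0 < m)%N ->
  ((fun n => \sum_(i < n) x i ^+ m) @ \oo --> power_sum x m)%classic.
Proof.
case: m => // m _.
have -> : (fun n => \sum_(i < n) x i ^+ m.+1) = series (fun i => x i ^+ m.+1).
  by apply/funext => n; rewrite seriesEord.
pose M := limn (series x).
have xM i : x i <= M.
  apply: le_trans (nondecreasing_cvgn_le _ x_summable i.+1).
    by rewrite seriesEnat /= big_nat_recr //= lerDr sumr_ge0.
  by apply: nondecreasing_series => n _ _; exact: x_ge0.
apply: (@series_le_cvg _ (fun i => x i ^+ m.+1) (fun i => M ^+ m * x i)) => [i|i|i|].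
- exact: exprn_ge0.
- by rewrite mulr_ge0 ?exprn_ge0 // (le_trans (x_ge0 0%N)).
- by rewrite exprSr ler_wpM2r // lerXn2r ?nnegrE // (le_trans (x_ge0 0%N)).
exact: is_cvg_seriesZ.
Qed.

Lemma cvg_S_function N (I : 'I_(nparts N)) :
  ((fun n => \sum_(J < nparts N) g_coef R J / N`!%:R * (chi_val I J)%:~R *
     \prod_(1 <= m < N.+1) (\sum_(i < n) x i ^+ m) ^+ mult J m) @ \oo --> S_function I x)%classic.
Proof.
apply: cvg_big => [|J _]; first exact: add_continuous.
apply: cvgMl_tmp.
(* [big_nat] moves the bound 1 <= m into the condition, where [cvg_power_sum] can use it. *)
rewrite big_nat; under eq_fun do rewrite big_nat.
apply: cvg_big => [|m /andP[m0 _]]; first exact: mul_continuous.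
exact: (cvg_comp _ (fun y : R => y ^+ mult J m) (cvg_power_sum m0) (@exprn_continuous R (mult J m) _)).
Qed.

End PowerSums.

Theorem theorem3 (R : realType) (N q : nat) (beta : R) (eps : nat -> R)
    (N_ge1 : (1 <= N)%N) (q_ge1 : (1 <= q)%N) (beta_gt0 : 0 < beta)
    (eps_nondecreasing : forall i j : nat, (i <= j)%N -> eps i <= eps j)
    (eps_summable : cvgn (series (fun i => expR (- beta * eps i)))) :
  gentile_Z eps q beta N =
  (\sum_(I < nparts N)
     (Qcoef q I)%:~R * S_function I (fun i => expR (- beta * eps i)))%:E.
Proof.
apply: canonical_Z_lim; set x := fun i => expR (- beta * eps i).
have x_ge0 i : 0 <= x i by exact: expR_ge0.
have cv : ((fun n => \sum_(I < nparts N) (Qcoef q I)%:~R * (\sum_(J < nparts N)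
     g_coef R J / N`!%:R * (chi_val I J)%:~R *
     \prod_(1 <= m < N.+1) (\sum_(i < n) x i ^+ m) ^+ mult J m)) @ \oo -->
   \sum_(I < nparts N) (Qcoef q I)%:~R * S_function I x)%classic.
  apply: cvg_big => [|I _]; first exact: add_continuous.
  apply: cvgMl_tmp; exact: cvg_S_function.
apply: cvg_trans cv; apply: near_eq_cvg; near=> n.
(* The finite identity is available from N levels on, hence eventually. *)
rewrite (gentile_finite N_ge1 q (fun i : 'I_n => x i)); last first.
  by near: n; exact: nbhs_infty_ge.
by apply: eq_bigl => c; rewrite inE.
Unshelve. all: by end_near.
Qed.
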